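(* Let $\mathcal{W}\subset\mathbb{R}^m$ be a bounded convex domain, $\tilde I$ a bounded interval, and $\mathscr{G}:\mathcal{W}\to L^\infty(\tilde I)$, $\omega\mapsto\tilde g(\cdot,\omega)$. Suppose $\mathscr{G}$ extends to a holomorphic (Banach-space-valued) map, bounded on compact subsets, on an open set $\mathcal{U}\subset\mathbb{C}^m$ containing $\overline{\mathcal{W}}$. Let $\widetilde{\mathcal{D}}=\mathscr{G}(\mathcal{W})$. Then there are constants $C_4,C_5>0$ and $C>0$ independent of $n$ such that for all $n\ge1$ $$d_n(\widetilde{\mathcal{D}})_{L^\infty(\tilde I)}\le Ce^{-C_4n^{1/m}},\qquad \varepsilon_n(B_1(\widetilde{\mathcal{D}}))_{L^\infty(\tilde I)}\le Ce^{-C_5n^{1/(m+1)}}.$$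
   Context: Kolmogorov $n$-width: $d_n(F)_X=\inf_{\dim V=n}\sup_{f\in F}\inf_{g\in V}\|f-g\|_X$. Entropy numbers: $\varepsilon_n(F)_X=\inf\{\varepsilon>0: F\text{ is covered by }2^n\text{ balls of radius }\varepsilon\text{ in }X\}$. $B_1(\widetilde{\mathcal{D}})$ is the closure in $X$ of $\{\sum_{j=1}^k c_jg_j: k\in\mathbb{N}, g_j\in\widetilde{\mathcal{D}}, \sum_j|c_j|\le1\}$. *)

(* Defs.v *)
From HB Require Import structures.
From mathcomp Require Import all_boot all_order all_algebra.
From mathcomp Require Import all_classical all_reals all_analysis.
From mathcomp Require Import ess_sup_inf.
From mathcomp Require Import complex.

Set Implicit Arguments.
Unset Strict Implicit.
Unset Printing Implicit Defensive.

Import Order.TTheory GRing.Theory Num.Theory.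
Import numFieldNormedType.Exports.

Local Open Scope classical_set_scope.
Local Open Scope ring_scope.

(** C^m is represented as R^m x R^m: (x, y) stands for x + i y. *)
Notation cvec R m := ('rV[R]_m * 'rV[R]_m)%type.

Section Defs.
Variable R : realType.

Definition cabs (z : R[i]) : R := Num.sqrt (complex.Re z ^+ 2 + complex.Im z ^+ 2).

Definition lebI (a b : R) := mrestr (@lebesgue_measure R) (measurable_itv `[a, b]).

Definition linf (a b : R) (f : R -> R) : \bar R :=
  ess_sup (lebI a b) (fun x => (`|f x|)%:E).

Definition Linf (a b : R) (f : R -> R) : Prop :=
  measurable_fun `[a, b] f /\ (linf a b f < +oo)%E.

Definition linfC (a b : R) (f : R -> R[i]) : \bar R :=
  ess_sup (lebI a b) (fun x => (cabs (f x))%:E).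

Definition LinfC (a b : R) (f : R -> R[i]) : Prop :=
  measurable_fun `[a, b] (fun x => complex.Re (f x)) /\
  measurable_fun `[a, b] (fun x => complex.Im (f x)) /\
  (linfC a b f < +oo)%E.

Definition ccoord (m : nat) (z : cvec R m) (j : 'I_m) : R[i] :=
  complex.Complex (z.1 0 j) (z.2 0 j).

Definition creal (m : nat) (x : 'rV[R]_m) : cvec R m := (x, 0).

(** G : U -> L^oo(I~; C) is holomorphic (complex Frechet differentiable in
    the L^oo norm) at every point of U: the derivative is the C-linear map
    h |-> sum_j h_j A_j with A_j in L^oo(I~; C). *)
Definition holomorphic_Linf (a b : R) (m : nat) (U : set (cvec R m))
    (G : cvec R m -> R -> R[i]) : Prop :=
  forall z, U z ->
    exists A : 'I_m -> R -> R[i],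
      (forall j, LinfC a b (A j)) /\
      forall e : R, 0 < e -> exists d : R, 0 < d /\
        forall h : cvec R m, `|h| < d ->
          (linfC a b (fun t => (G (z + h) t - G z t
                               - \sum_(j < m) ccoord h j * A j t)%R)
            <= (e * `|h|)%:E)%E.

Definition bounded_on_compacts (a b : R) (m : nat) (U : set (cvec R m))
    (G : cvec R m -> R -> R[i]) : Prop :=
  forall K : set (cvec R m), K `<=` U -> compact K ->
    exists M : R, forall z, K z -> (linfC a b (G z) <= M%:E)%E.

(** Kolmogorov n-width in L^oo(I~): infimum over subspaces V of L^oo(I~)
    spanned by n elements (i.e. dim V <= n) of sup_{f in F} dist(f, V). *)
Definition kwidth (a b : R) (F : set (R -> R)) (n : nat) : \bar R :=
  ereal_inf [set ereal_sup
      [set ereal_inf [set linf a b (fun t => f t - \sum_(i < n) c i * B i t)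
                     | c in [set: 'I_n -> R]]
      | f in F]
    | B in [set B : 'I_n -> R -> R | forall i, Linf a b (B i)]].

Definition entropy_num (a b : R) (F : set (R -> R)) (n : nat) : \bar R :=
  ereal_inf [set e%:E | e in [set e : R | 0 < e /\
     exists c : 'I_(2 ^ n) -> R -> R, (forall i, Linf a b (c i)) /\
       forall f, F f -> exists i, (linf a b (fun t => (f t - c i t)%R) <= e%:E)%E]].

Definition B1 (a b : R) (D : set (R -> R)) : set (R -> R) :=
  [set f | Linf a b f /\
     forall e : R, 0 < e -> exists (k : nat) (c : 'I_k -> R) (g : 'I_k -> R -> R),
       \sum_(j < k) `|c j| <= 1 /\ (forall j, D (g j)) /\
       (linf a b (fun t => (f t - \sum_(j < k) c j * g j t)%R) < e%:E)%E].

End Defs.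

(* Main.v *)
(** Around each point of the closure of W the map G is holomorphic and bounded
    on a small polydisc.  Expanding G there by tensor-product Newton
    interpolation at real nodes clustered near the centre, all basis functions
    are real combinations of values of Re G, and the error decays geometrically:
    by Cauchy's formula on the unit square a divided difference at nodes in
    [0, 1/5] is a contour integral with poles at distance at least 4/5 from the
    contour, so it grows at most like (5/4)^k, while the Newton monomials decay
    like (2/5)^k.  The L^oo-valued estimates follow from scalar ones by testing
    against the functionals f |-> \int_E f, E a measurable subset of [a, b].
    By compactness finitely many polydiscs suffice, so J N^m functions
    approximate g to within O(2^-N) with coefficients in [-1, 1].  This bounds
    the width; absolutely convex combinations of the g(w) have coefficients in
    [-1, 1] as well, so rounding these to O(N) bits gives a net of
    2^O(N^(m+1)) points for B_1. *)

Require Import Defs.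
From HB Require Import structures.
From mathcomp Require Import all_boot all_order all_algebra.
From mathcomp Require Import all_classical all_reals all_analysis.
From mathcomp Require Import ess_sup_inf.
From mathcomp Require Import complex.
From mathcomp Require Import measurable_realfun zify ring lra.

Set Implicit Arguments.
Unset Strict Implicit.
Unset Printing Implicit Defensive.

Import Order.TTheory GRing.Theory Num.Theory.
Import numFieldNormedType.Exports.

Local Open Scope classical_set_scope.
Local Open Scope ring_scope.

(** Elements of L^oo are determined only up to null sets, so for a fixed [t] nothing is known of
    [z |-> G z t], and no contour integral can be formed pointwise in [t]. This shapes the proof in
    two ways. Divided differences are used because they are finite combinations of values of [G]:
    the basis functions are then in L^oo without any vector-valued integral, and Cauchy's formula
    only serves to bound scalar quantities. And every scalar estimate is kept proportional to the
    measure of the test set E, since such a family of estimates returns to the L^oo norm at the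
    price of a factor 2.

    The constant 1/5 has this origin. On the square of half-side 1, with nodes and arguments within
    s of the centre, the monomials are of size (2 s)^k and the divided differences of size (1 -
    s)^-k. The product decays as soon as s < 1/3, and s = 1/5 gives the ratio 1/2 exactly. *)

Section ComplexModulus.
Variable R : realType.
Implicit Types (z w : R[i]) (x : R).

Lemma cabs_norm z : (cabs z)%:C%C = `|z|.
Proof. by case: z => a b. Qed.

Lemma cabs_ge0 z : 0 <= cabs z.
Proof. exact: sqrtr_ge0. Qed.

Lemma cabsM z w : cabs (z * w) = cabs z * cabs w.
Proof. by apply: complexI; rewrite rmorphM /= !cabs_norm normrM. Qed.

Lemma cabsV z : cabs z^-1 = (cabs z)^-1.
Proof. by apply: complexI; rewrite fmorphV /= !cabs_norm normfV. Qed.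

Lemma cabsD z w : cabs (z + w) <= cabs z + cabs w.
Proof. by rewrite -lecR rmorphD /= !cabs_norm ler_normD. Qed.

Lemma cabsN z : cabs (- z) = cabs z.
Proof. by apply: complexI; rewrite !cabs_norm normrN. Qed.

Lemma cabsB z w : cabs (z - w) <= cabs z + cabs w.
Proof. by rewrite -(cabsN w) cabsD. Qed.

Lemma cabs0 : cabs 0 = 0 :> R.
Proof. by apply: complexI; rewrite cabs_norm normr0. Qed.

Lemma cabs1 : cabs 1 = 1 :> R.
Proof. by apply: complexI; rewrite cabs_norm normr1. Qed.

Lemma cabs_eq0 z : (cabs z == 0) = (z == 0).
Proof. by rewrite -(inj_eq (@complexI R)) cabs_norm normr_eq0. Qed.

Lemma cabs_gt0 z : z != 0 -> 0 < cabs z.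
Proof. by move=> z0; rewrite lt_def cabs_ge0 cabs_eq0 z0. Qed.

Lemma cabsX z n : cabs (z ^+ n) = cabs z ^+ n.
Proof. by elim: n => [|n IH]; rewrite ?expr0 ?cabs1// !exprS cabsM IH. Qed.

Lemma cabs_real x : cabs x%:C%C = `|x|.
Proof. by rewrite /cabs /= expr0n addr0 sqrtr_sqr. Qed.

Lemma cabs_i : cabs 'i%C = 1 :> R.
Proof. by rewrite /cabs /= expr0n add0r sqrtr_sqr normr1. Qed.

Lemma Re_le_cabs z : `|complex.Re z| <= cabs z.
Proof. by rewrite /cabs -sqrtr_sqr ler_wsqrtr// lerDl sqr_ge0. Qed.

Lemma Im_le_cabs z : `|complex.Im z| <= cabs z.
Proof. by rewrite /cabs -sqrtr_sqr ler_wsqrtr// lerDr sqr_ge0. Qed.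

Lemma cabs_le_ReIm z : cabs z <= `|complex.Re z| + `|complex.Im z|.
Proof.
rewrite -(@ler_pXn2r _ 2) ?nnegrE ?addr_ge0 ?cabs_ge0//.
rewrite sqr_sqrtr ?addr_ge0 ?sqr_ge0// sqrrD !real_normK ?num_real//.
by rewrite addrAC lerDl mulrn_wge0// mulr_ge0.
Qed.

Lemma Re_add z w : complex.Re (z + w) = complex.Re z + complex.Re w.
Proof. by case: z w => [? ?] []. Qed.
Lemma Im_add z w : complex.Im (z + w) = complex.Im z + complex.Im w.
Proof. by case: z w => [? ?] []. Qed.
Lemma Re_opp z : complex.Re (- z) = - complex.Re z.
Proof. by case: z. Qed.
Lemma Im_opp z : complex.Im (- z) = - complex.Im z.
Proof. by case: z. Qed.
Lemma Re_mul z w : complex.Re (z * w) =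
  complex.Re z * complex.Re w - complex.Im z * complex.Im w.
Proof. by case: z w => [? ?] []. Qed.
Lemma Im_mul z w : complex.Im (z * w) =
  complex.Re z * complex.Im w + complex.Im z * complex.Re w.
Proof. by case: z w => [? ?] []. Qed.

Definition ReImE := (Re_add, Im_add, Re_opp, Im_opp, Re_mul, Im_mul).

Lemma eq_ReIm z w : complex.Re z = complex.Re w -> complex.Im z = complex.Im w ->
  z = w.
Proof. by case: z w => [? ?] [? ?] /= -> ->. Qed.

End ComplexModulus.

(** * Complex differentiability and contour integrals over rectangles *)

Section ComplexDifferentiability.
Variable R : realType.
Implicit Types (f h : R[i] -> R[i]) (z w : R[i]).

Definition ccont f z := forall e : R, 0 < e -> exists d : R, 0 < d /\
  forall w, cabs w < d -> cabs (f (z + w) - f z) <= e.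

(** The bound is stated without division by [w] and with a weak inequality, so that [w = 0] is no
    special case. *)
Definition cdiff f z := exists A : R[i], forall e : R, 0 < e ->
  exists d : R, 0 < d /\ forall w, cabs w < d ->
    cabs (f (z + w) - f z - A * w) <= e * cabs w.

Lemma cdiff_ccont f z : cdiff f z -> ccont f z.
Proof.
move=> [A /(_ 1 ltr01)[d [d0 H]]] e e0.
have A0 : 0 < 1 + cabs A by rewrite ltr_pwDl ?cabs_ge0.
exists (Num.min d (e / (1 + cabs A))); split.
  by rewrite lt_min d0 divr_gt0.
move=> w; rewrite lt_min => /andP[wd we].
have -> : f (z + w) - f z = (f (z + w) - f z - A * w) + A * w by ring.
apply: (le_trans (cabsD _ _)); rewrite cabsM.
apply: (le_trans (lerD (H w wd) (lexx _))).
by rewrite -mulrDl mulrC -ler_pdivlMr// ltW.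
Qed.

Lemma cdiff_cst (c : R[i]) z : cdiff (fun=> c) z.
Proof.
exists 0 => e e0; exists 1; split=> // w _.
by rewrite mul0r subrr subr0 cabs0 mulr_ge0 ?cabs_ge0 ?ltW.
Qed.

Lemma cdiff_id z : cdiff id z.
Proof.
exists 1 => e e0; exists 1; split=> // w _.
by rewrite (_ : z + w - z - 1 * w = 0) ?cabs0 ?mulr_ge0 ?cabs_ge0 ?(ltW e0)//; ring.
Qed.

Lemma cdiffD f h z : cdiff f z -> cdiff h z -> cdiff (fun x => f x + h x) z.
Proof.
move=> [A Hf] [B Hh]; exists (A + B) => e e0.
have e20 : 0 < e / 2 by rewrite divr_gt0.
have [d1 [d10 H1]] := Hf _ e20; have [d2 [d20 H2]] := Hh _ e20.
exists (Num.min d1 d2); split; first by rewrite lt_min d10.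
move=> w; rewrite lt_min => /andP[w1 w2].
have -> : f (z + w) + h (z + w) - (f z + h z) - (A + B) * w =
  (f (z + w) - f z - A * w) + (h (z + w) - h z - B * w) by ring.
apply: (le_trans (cabsD _ _)); apply: (le_trans (lerD (H1 w w1) (H2 w w2))).
by rewrite -mulrDl -splitr.
Qed.

Lemma cdiffM f h z : cdiff f z -> cdiff h z -> cdiff (fun x => f x * h x) z.
Proof.
move=> df dh; have [A Hf] := df; have [B Hh] := dh.
exists (A * h z + f z * B) => e e0.
(* The error below splits into four terms, each at most [e' * cabs w] times one of the four summands
   of [K]; the summand 1 bounds the increment of [h]. *)
set K := 1 + cabs (h z) + cabs A + cabs (f z).
have K0 : 0 < K by rewrite /K; have := cabs_ge0 (h z);
  have := cabs_ge0 (f z); have := cabs_ge0 A; lra.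
set e' := Num.min 1 (e / K).
have e'0 : 0 < e' by rewrite lt_min ltr01 divr_gt0.
have [d1 [d10 H1]] := Hf _ e'0; have [d2 [d20 H2]] := Hh _ e'0.
have [d3 [d30 H3]] := cdiff_ccont dh e'0.
exists (Num.min d1 (Num.min d2 d3)); split; first by rewrite !lt_min d10 d20.
move=> w; rewrite !lt_min => /and3P[w1 w2 w3].
have -> : f (z + w) * h (z + w) - f z * h z - (A * h z + f z * B) * w =
  (f (z + w) - f z - A * w) * h z +
  (f (z + w) - f z - A * w) * (h (z + w) - h z) +
  A * w * (h (z + w) - h z) + f z * (h (z + w) - h z - B * w) by ring.
have P1 := H1 w w1; have P2 := H2 w w2; have P3 := H3 w w3.
have w0 := cabs_ge0 w.
have a0 := cabs_ge0 (h z); have b0 := cabs_ge0 A; have c0 := cabs_ge0 (f z).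
have e'1 : e' <= 1 by rewrite ge_min lexx.
have e'K : e' * K <= e by rewrite -ler_pdivlMr// ge_min lexx orbT.
have Q1 : cabs (f (z + w) - f z - A * w) * cabs (h z) <= e' * cabs w * cabs (h z).
  by rewrite ler_wpM2r.
have Q2 : cabs (f (z + w) - f z - A * w) * cabs (h (z + w) - h z) <= e' * cabs w * 1.
  by apply: ler_pM; rewrite ?cabs_ge0// (le_trans P3).
have Q3 : cabs A * cabs w * cabs (h (z + w) - h z) <= cabs A * cabs w * e'.
  by rewrite ler_wpM2l// mulr_ge0.
have Q4 : cabs (f z) * cabs (h (z + w) - h z - B * w) <= cabs (f z) * (e' * cabs w).
  by rewrite ler_wpM2l.
have Q5 : e' * K * cabs w <= e * cabs w by rewrite ler_wpM2r.
have T1 := cabsD ((f (z + w) - f z - A * w) * h z +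
  (f (z + w) - f z - A * w) * (h (z + w) - h z) +
  A * w * (h (z + w) - h z)) (f z * (h (z + w) - h z - B * w)).
have T2 := cabsD ((f (z + w) - f z - A * w) * h z +
  (f (z + w) - f z - A * w) * (h (z + w) - h z)) (A * w * (h (z + w) - h z)).
have T3 := cabsD ((f (z + w) - f z - A * w) * h z)
  ((f (z + w) - f z - A * w) * (h (z + w) - h z)).
move: T1 T2 T3; rewrite !cabsM => T1 T2 T3.
by move: Q5; rewrite /K; lra.
Qed.

(** With u = z - a the remainder is exactly w^2 / ((u + w) u^2). The first bound on [w] keeps |u +
    w| above r / 2, the second makes |w| at most e (r / 2) r^2. *)
Lemma cdiff_inv (a z : R[i]) : z != a -> cdiff (fun x => (x - a)^-1) z.
Proof.
move=> za; have u0 : z - a != 0 by rewrite subr_eq0.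
set u := z - a in u0 *; set r := cabs u.
have r0 : 0 < r by exact: cabs_gt0.
exists (- (u ^- 2)) => e e0.
exists (Num.min (r / 2) (e * r ^+ 3 / 2)); split.
  by rewrite lt_min !divr_gt0 ?mulr_gt0 ?exprn_gt0.
move=> w; rewrite lt_min => /andP[w1 w2].
have rw : r / 2 <= cabs (u + w).
  have : r <= cabs (u + w) + cabs w.
    by rewrite /r [X in cabs X <= _](_ : u = (u + w) - w) ?cabsB//; ring.
  lra.
have uw0 : u + w != 0 by rewrite -cabs_eq0; apply/eqP => h; move: rw; rewrite h; lra.
have -> : z + w - a = u + w by rewrite /u; ring.
have -> : (u + w)^-1 - u^-1 - - (u ^- 2) * w = w * w * ((u + w)^-1 * u ^- 2).
  by field; rewrite ?u0 ?uw0.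
rewrite !cabsM !cabsV cabsX -/r mulrAC ler_wpM2r ?cabs_ge0//.
have p0 : 0 < cabs (u + w) by exact: cabs_gt0.
rewrite -invfM ler_pdivrMr ?mulr_gt0 ?exprn_gt0//.
apply: (le_trans (ltW w2)).
have -> : e * r ^+ 3 / 2 = e * (r / 2 * r ^+ 2) by field.
by rewrite ler_wpM2l ?(ltW e0)// ler_wpM2r ?exprn_ge0 ?(ltW r0).
Qed.

Lemma eq_cdiff f h z : f =1 h -> cdiff f z -> cdiff h z.
Proof. by move=> /funext ->. Qed.

End ComplexDifferentiability.

(** * Integrals of complex-valued functions over a segment *)

Section ComplexIntegral.
Variable R : realType.
Notation mu := (@lebesgue_measure R).
Implicit Types (f h : R -> R[i]) (a b : R).

(** Continuity is two-sided even at the endpoints, as [s] is not confined to [a, b]; the integrands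
    satisfy this because they are continuous in the plane at each point of the contour. *)
Definition icont a b f := forall t, a <= t <= b -> forall e : R, 0 < e ->
  exists d : R, 0 < d /\ forall s, `|s - t| < d -> cabs (f s - f t) <= e.

Definition cint a b f : R[i] :=
  Complex (\int[mu]_(t in `[a, b]) complex.Re (f t))
          (\int[mu]_(t in `[a, b]) complex.Im (f t)).

(** Here [p] stands for the real or the imaginary part. *)
Lemma icont_integrable (p : R[i] -> R) a b f :
  (forall z w, p (z - w) = p z - p w) -> (forall z, `|p z| <= cabs z) ->
  icont a b f -> mu.-integrable `[a, b] (EFin \o (fun t => p (f t))).
Proof.
move=> pB pc cf; apply: continuous_compact_integrable.
  exact: segment_compact.
apply: continuous_in_subspaceT => t; rewrite inE/= in_itv/= => tab.
apply/(@cvgrPdist_le _ R^o) => e e0; have [d [d0 H]] := cf t tab e e0.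
exists d => //= s; rewrite /= => sd.
by rewrite distrC -pB (le_trans (pc _))// H// distrC.
Qed.

Lemma icont_Re a b f : icont a b f ->
  mu.-integrable `[a, b] (EFin \o (fun t => complex.Re (f t))).
Proof.
apply: icont_integrable; first by move=> z w; rewrite !ReImE.
exact: Re_le_cabs.
Qed.

Lemma icont_Im a b f : icont a b f ->
  mu.-integrable `[a, b] (EFin \o (fun t => complex.Im (f t))).
Proof.
apply: icont_integrable; first by move=> z w; rewrite !ReImE.
exact: Im_le_cabs.
Qed.

Lemma icontD a b f h : icont a b f -> icont a b h ->
  icont a b (fun t => f t + h t).
Proof.
move=> cf ch t tab e e0; have e20 : 0 < e / 2 by rewrite divr_gt0.
have [d1 [d10 H1]] := cf t tab _ e20; have [d2 [d20 H2]] := ch t tab _ e20.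
exists (Num.min d1 d2); split; first by rewrite lt_min d10.
move=> s; rewrite lt_min => /andP[/H1 s1 /H2 s2].
have -> : f s + h s - (f t + h t) = (f s - f t) + (h s - h t) by ring.
by rewrite (le_trans (cabsD _ _))// [leRHS]splitr lerD.
Qed.

Lemma icontZ a b (k : R[i]) f : icont a b f -> icont a b (fun t => k * f t).
Proof.
move=> cf t tab e e0; have k0 := cabs_ge0 k.
have e20 : 0 < e / (1 + cabs k) by rewrite divr_gt0// ltr_pwDl.
have [d [d0 H]] := cf t tab _ e20; exists d; split=> // s /H.
rewrite -mulrBr cabsM ler_pdivlMr ?ltr_pwDl// mulrC; apply: le_trans.
by rewrite ler_wpM2r ?cabs_ge0// lerDr.
Qed.

Lemma icontN a b f : icont a b f -> icont a b (fun t => - f t).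
Proof. by move=> /(icontZ (-1)); congr icont; apply/funext => t; rewrite mulN1r. Qed.

Lemma icontB a b f h : icont a b f -> icont a b h ->
  icont a b (fun t => f t - h t).
Proof. by move=> cf /icontN; exact: icontD. Qed.

Lemma icont_cst a b (k : R[i]) : icont a b (fun=> k).
Proof. by move=> t _ e e0; exists 1; split=> // s _; rewrite subrr cabs0 ltW. Qed.

Lemma eq_cint a b f h : (forall t, a <= t <= b -> f t = h t) ->
  cint a b f = cint a b h.
Proof.
move=> fh; congr Complex; apply: eq_Rintegral => t;
  by rewrite inE/= in_itv/= => /fh ->.
Qed.

Lemma cintD a b f h : icont a b f -> icont a b h ->
  cint a b (fun t => f t + h t) = cint a b f + cint a b h.
Proof.
move=> cf ch; apply: eq_ReIm; rewrite ReImE /=.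
  rewrite -RintegralD; [|exact: measurable_itv|exact: icont_Re|exact: icont_Re].
  by apply: eq_Rintegral => t _; rewrite ReImE.
rewrite -RintegralD; [|exact: measurable_itv|exact: icont_Im|exact: icont_Im].
by apply: eq_Rintegral => t _; rewrite ReImE.
Qed.

Lemma cintZ a b (k : R[i]) f : icont a b f ->
  cint a b (fun t => k * f t) = k * cint a b f.
Proof.
move=> cf; have mI := @measurable_itv R `[a, b].
have iR := icont_Re cf; have iI := icont_Im cf.
have iZ (r : R) (u : R -> R) : mu.-integrable `[a, b] (EFin \o u) ->
    mu.-integrable `[a, b] (EFin \o (fun t => r * u t)).
  by move=> iu; rewrite (_ : _ \o _ = (fun x => r%:E * (u x)%:E)%E)//; exact: integrableZl.
apply: eq_ReIm; rewrite ReImE /=.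
  rewrite -!RintegralZl// -RintegralB//; [|exact: iZ..].
  by apply: eq_Rintegral => t _; rewrite ReImE.
rewrite -!RintegralZl// -RintegralD//; [|exact: iZ..].
by apply: eq_Rintegral => t _; rewrite ReImE.
Qed.

Lemma cintB a b f h : icont a b f -> icont a b h ->
  cint a b (fun t => f t - h t) = cint a b f - cint a b h.
Proof.
move=> cf ch; rewrite cintD//; last exact: icontN.
congr (_ + _); rewrite -[RHS]mulN1r -cintZ//.
by apply: eq_cint => t _; rewrite mulN1r.
Qed.

Lemma Rint_cst a b (r : R) : a <= b -> \int[mu]_(t in `[a, b]) r = r * (b - a).
Proof.
move=> ab; rewrite Rintegral_cst; last exact: measurable_itv.
by rewrite /= lebesgue_measure_itv/= lte_fin; case: ltgtP ab => //= ->; rewrite subrr.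
Qed.

Lemma cint_cst a b (k : R[i]) : a <= b -> cint a b (fun=> k) = k * (b - a)%:C%C.
Proof.
move=> ab; apply: eq_ReIm; rewrite ReImE /= Rint_cst//; ring.
Qed.

Lemma cint_split a b c f : a <= b <= c -> icont a c f ->
  cint a c f = cint a b f + cint b c f.
Proof.
move=> /andP[ab bc] cf.
have key (u : R -> R) : mu.-integrable `[a, c] (EFin \o u) ->
    \int[mu]_(t in `[a, c]) u t = \int[mu]_(t in `[a, b]) u t + \int[mu]_(t in `[b, c]) u t.
  move=> iu; rewrite -(@Rintegral_itv_obnd_cbnd R b (BRight c)); last first.
    apply: integrableS iu => //=; apply: subset_itvr.
    by rewrite bnd_simp.
  by rewrite -(@Rintegral_itvB _ u (BLeft a) (BRight c) b)// ?bnd_simp// addrC subrK.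
by apply: eq_ReIm; rewrite ReImE /= key//; [exact: icont_Re|exact: icont_Im].
Qed.

(** The factor 2 comes from estimating the real and imaginary parts separately; all later bounds
    tolerate it. *)
Lemma cint_le a b f (M : R) : a <= b -> icont a b f ->
  (forall t, a <= t <= b -> cabs (f t) <= M) ->
  cabs (cint a b f) <= 2 * (M * (b - a)).
Proof.
move=> ab cf fM; have mI := @measurable_itv R `[a, b].
have key (u : R -> R) : mu.-integrable `[a, b] (EFin \o u) ->
    (forall t, a <= t <= b -> `|u t| <= M) ->
    `|\int[mu]_(t in `[a, b]) u t| <= M * (b - a).
  move=> iu uM; rewrite (le_trans (le_normr_Rintegral _ iu))//.
  rewrite -(Rint_cst M ab); apply: le_Rintegral => //.
  - exact: (integrable_norm iu).
  - exact: (icont_Re (icont_cst (M%:C)%C)).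
rewrite (le_trans (cabs_le_ReIm _))//= mulr2n mulrDl mul1r lerD//; apply: key.
- exact: icont_Re.
- by move=> t /fM; apply: le_trans; exact: Re_le_cabs.
- exact: icont_Im.
- by move=> t /fM; apply: le_trans; exact: Im_le_cabs.
Qed.

End ComplexIntegral.

(** * Contour integrals over rectangles and Goursat's theorem *)

Section Goursat.
Variable R : realType.
Implicit Types (h f : R[i] -> R[i]) (a b c d x y : R).

(** The counterclockwise contour integral over the boundary of [a, b] x [c, d], with opposite sides
    paired: dz is dt on horizontal sides and i ds on vertical ones. *)
Definition rectint a b c d h : R[i] :=
  cint a b (fun t => h (Complex t c) - h (Complex t d)) +
  'i%C * cint c d (fun s => h (Complex b s) - h (Complex a s)).

Lemma icont_hor a b c h : (forall t, a <= t <= b -> ccont h (Complex t c)) ->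
  icont a b (fun t => h (Complex t c)).
Proof.
move=> ch t tab e e0; have [d [d0 H]] := ch t tab e e0.
exists d; split=> // s sd.
have -> : Complex s c = Complex t c + (s - t)%:C%C.
  by apply: eq_ReIm; rewrite !ReImE /=; ring.
by apply: H; rewrite cabs_real.
Qed.

Lemma icont_ver a c d h : (forall s, c <= s <= d -> ccont h (Complex a s)) ->
  icont c d (fun s => h (Complex a s)).
Proof.
move=> ch t tab e e0; have [r [r0 H]] := ch t tab e e0.
exists r; split=> // s sd.
have -> : Complex a s = Complex a t + (s - t)%:C%C * 'i%C.
  by apply: eq_ReIm; rewrite !ReImE /=; ring.
by apply: H; rewrite cabsM cabs_real cabs_i mulr1.
Qed.

Definition bdcont a b c d h :=
  [/\ icont a b (fun t => h (Complex t c)), icont a b (fun t => h (Complex t d)),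
      icont c d (fun s => h (Complex a s)) & icont c d (fun s => h (Complex b s))].

Lemma bdcontP a b c d h : a <= b -> c <= d ->
  (forall x y, a <= x <= b -> c <= y <= d ->
     x = a \/ x = b \/ y = c \/ y = d -> ccont h (Complex x y)) ->
  bdcont a b c d h.
Proof.
move=> ab cd H; split.
- by apply: icont_hor => t tab; apply: H; rewrite ?lexx//; tauto.
- by apply: icont_hor => t tab; apply: H; rewrite ?lexx ?andbT//; tauto.
- by apply: icont_ver => t tab; apply: H; rewrite ?lexx//; tauto.
- by apply: icont_ver => t tab; apply: H; rewrite ?lexx ?andbT//; tauto.
Qed.

Lemma bdcontB a b c d h f : bdcont a b c d h -> bdcont a b c d f ->
  bdcont a b c d (fun z => h z - f z).
Proof. by move=> [? ? ? ?] [? ? ? ?]; split; exact: icontB. Qed.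

Lemma bdcontD a b c d h f : bdcont a b c d h -> bdcont a b c d f ->
  bdcont a b c d (fun z => h z + f z).
Proof. by move=> [? ? ? ?] [? ? ? ?]; split; exact: icontD. Qed.

Lemma bdcontZ a b c d (k : R[i]) h : bdcont a b c d h ->
  bdcont a b c d (fun z => k * h z).
Proof. by move=> [? ? ? ?]; split; exact: icontZ. Qed.

Lemma rectintD a b c d h f : bdcont a b c d h -> bdcont a b c d f ->
  rectint a b c d (fun z => h z + f z) = rectint a b c d h + rectint a b c d f.
Proof.
move=> [h1 h2 h3 h4] [f1 f2 f3 f4]; rewrite /rectint.
rewrite !cintB ?cintD//; try exact: icontD.
by ring.
Qed.

Lemma rectintZ a b c d (k : R[i]) h : bdcont a b c d h ->
  rectint a b c d (fun z => k * h z) = k * rectint a b c d h.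
Proof.
move=> [h1 h2 h3 h4]; rewrite /rectint.
rewrite !cintB ?cintZ//; try exact: icontZ.
by ring.
Qed.

Lemma rectintB a b c d h f : bdcont a b c d h -> bdcont a b c d f ->
  rectint a b c d (fun z => h z - f z) = rectint a b c d h - rectint a b c d f.
Proof.
move=> bh bf; rewrite rectintD//; last first.
  by case: bf => *; split; exact: icontN.
congr (_ + _); rewrite -[RHS]mulN1r -rectintZ//.
by congr rectint; apply/funext => z; rewrite mulN1r.
Qed.

(** Each pair of sides has an integrand of size 2 M, and [cint_le] contributes another factor 2. *)
Lemma rectint_le a b c d h (M : R) : a <= b -> c <= d -> bdcont a b c d h ->
  (forall x y, a <= x <= b -> c <= y <= d ->
     x = a \/ x = b \/ y = c \/ y = d -> cabs (h (Complex x y)) <= M) ->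
  cabs (rectint a b c d h) <= 4 * M * ((b - a) + (d - c)).
Proof.
move=> ab cd [h1 h2 h3 h4] H.
rewrite (le_trans (cabsD _ _))// cabsM cabs_i mul1r.
have E1 : cabs (cint a b (fun t => h (Complex t c) - h (Complex t d))) <=
    2 * ((M + M) * (b - a)).
  apply: cint_le => //; first exact: icontB.
  move=> t tab; rewrite (le_trans (cabsB _ _))// lerD//; apply: H => //;
    rewrite ?lexx ?cd//; tauto.
have E2 : cabs (cint c d (fun t => h (Complex b t) - h (Complex a t))) <=
    2 * ((M + M) * (d - c)).
  apply: cint_le => //; first exact: icontB.
  move=> t tab; rewrite (le_trans (cabsB _ _))// lerD//; apply: H => //;
    rewrite ?lexx ?ab//; tauto.
lra.
Qed.

(** On each pair of sides the difference is constant, so the two integrals are explicit and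
    cancel. *)
Lemma rectint_affine a b c d (p q : R[i]) : a <= b -> c <= d ->
  rectint a b c d (fun z => p + q * z) = 0.
Proof.
move=> ab cd; rewrite /rectint.
rewrite (@eq_cint _ _ _ _ (fun=> q * ('i%C * (c - d)%:C%C))); last first.
  by move=> t _; apply: eq_ReIm; rewrite !ReImE /=; ring.
rewrite (@eq_cint _ c d _ (fun=> q * (b - a)%:C%C)); last first.
  by move=> t _; apply: eq_ReIm; rewrite !ReImE /=; ring.
rewrite !cint_cst//; apply: eq_ReIm; rewrite !ReImE /=; ring.
Qed.

Lemma rectint_splitx a e b c d h : a <= e <= b -> bdcont a b c d h ->
  icont c d (fun s => h (Complex e s)) ->
  rectint a b c d h = rectint a e c d h + rectint e b c d h.
Proof.
move=> /andP[ae eb] [h1 h2 h3 h4] h5; rewrite /rectint.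
rewrite (@cint_split _ a e b) ?ae//; last exact: icontB.
by rewrite !(@cintB _ c d)//; ring.
Qed.

Lemma rectint_splity a b c e d h : c <= e <= d -> bdcont a b c d h ->
  icont a b (fun t => h (Complex t e)) ->
  rectint a b c d h = rectint a b c e h + rectint a b e d h.
Proof.
move=> /andP[ce ed] [h1 h2 h3 h4] h5; rewrite /rectint.
rewrite (@cint_split _ c e d) ?ce//; last exact: icontB.
by rewrite !(@cintB _ a b)//; ring.
Qed.

Lemma rectint_quarters x y (u v : R) h : 0 <= u -> 0 <= v ->
  (forall s t, x <= s <= x + u + u -> y <= t <= y + v + v ->
     ccont h (Complex s t)) ->
  rectint x (x + u + u) y (y + v + v) h =
    rectint x (x + u) y (y + v) h + rectint x (x + u) (y + v) (y + v + v) h +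
    (rectint (x + u) (x + u + u) y (y + v) h +
     rectint (x + u) (x + u + u) (y + v) (y + v + v) h).
Proof.
move=> u0 v0 cont.
have xs : x <= x + u <= x + u + u by lra.
have ys : y <= y + v <= y + v + v by lra.
have cth p q t : x <= p -> q <= x + u + u -> y <= t <= y + v + v ->
    icont p q (fun s => h (Complex s t)).
  move=> xp qx ty; apply: icont_hor => s /andP[ps sq]; apply: cont => //.
  by rewrite (le_trans xp ps) (le_trans sq qx).
have ctv p q t : y <= p -> q <= y + v + v -> x <= t <= x + u + u ->
    icont p q (fun s => h (Complex t s)).
  move=> xp qx ty; apply: icont_ver => s /andP[ps sq]; apply: cont => //.
  by rewrite (le_trans xp ps) (le_trans sq qx).
have [xs1 xs2] := andP xs; have [ys1 ys2] := andP ys.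
have xs3 := le_trans xs1 xs2; have ys3 := le_trans ys1 ys2.
rewrite (@rectint_splitx x (x + u)) //; first last.
- exact: ctv.
- by split; [apply: cth|apply: cth|apply: ctv|apply: ctv]; rewrite ?lexx ?xs3 ?ys3.
rewrite (@rectint_splity x _ y (y + v)) //; first last.
- exact: cth.
- by split; [apply: cth|apply: cth|apply: ctv|apply: ctv];
    rewrite ?lexx ?xs1 ?xs2 ?xs3 ?ys3.
rewrite (@rectint_splity (x + u) _ y (y + v)) //; first last.
- exact: cth.
- by split; [apply: cth|apply: cth|apply: ctv|apply: ctv];
    rewrite ?lexx ?xs1 ?xs2 ?xs3 ?ys3.
Qed.

(** Left endpoints increase and each right endpoint bounds all of them, so their supremum lies in
    every interval. *)
Lemma halving_intervals (u : nat -> R) (w : R) :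
  (forall n, u n <= u n.+1 /\ u n.+1 + w / 2 ^+ n.+1 <= u n + w / 2 ^+ n) ->
  0 <= w ->
  exists x, forall n, u n <= x <= u n + w / 2 ^+ n.
Proof.
move=> H w0.
have up n k : u n <= u (n + k)%N.
  elim: k => [|k IH]; first by rewrite addn0.
  by rewrite addnS (le_trans IH)//; case: (H (n + k)%N).
have dn n k : u (n + k)%N + w / 2 ^+ (n + k) <= u n + w / 2 ^+ n.
  elim: k => [|k IH]; first by rewrite addn0.
  by rewrite addnS; apply: le_trans IH; case: (H (n + k)%N).
have wn n : 0 <= w / 2 ^+ n by rewrite divr_ge0// exprn_ge0.
have uub n m : u m <= u n + w / 2 ^+ n.
  rewrite (le_trans (up m n))// addnC (le_trans _ (dn n m))//.
  by rewrite lerDl.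
exists (sup (range u)) => n; apply/andP; split.
  apply: ub_le_sup; last by exists n.
  by exists (u 0%N + w / 2 ^+ 0) => _ [m _ <-]; exact: uub.
by apply: ge_sup; [exists (u 0%N); exists 0%N|move=> _ [m _ <-]; exact: uub].
Qed.

(** Bisection: a rectangle whose integral is too large compared with the square of its
    half-perimeter has a quarter with the same defect. At the limit point of the nested quarters,
    differentiability contradicts this defect. *)
Theorem goursat a b c d h : a <= b -> c <= d ->
  (forall x y, a <= x <= b -> c <= y <= d -> cdiff h (Complex x y)) ->
  rectint a b c d h = 0.
Proof.
move=> ab cd dh; apply/eqP; rewrite -cabs_eq0 eq_le cabs_ge0 andbT.
apply/ler_addgt0Pr => e0' e0'0; rewrite add0r leNgt; apply/negP => big.
set w := b - a; set l := d - c.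
have w0 : 0 <= w by rewrite subr_ge0.
have l0 : 0 <= l by rewrite subr_ge0.
(* Chosen so that e (w + l)^2 is at most [e0'], which makes the whole rectangle bad; the added 1
   keeps the denominator positive for a degenerate rectangle. *)
set e := e0' / (1 + (w + l) ^+ 2).
have s1 : 0 < 1 + (w + l) ^+ 2 by rewrite ltr_pwDl ?sqr_ge0.
have e0 : 0 < e by rewrite divr_gt0.
pose W n := w / 2 ^+ n; pose L n := l / 2 ^+ n.
have W0 n : 0 <= W n by rewrite divr_ge0// exprn_ge0.
have L0 n : 0 <= L n by rewrite divr_ge0// exprn_ge0.
have WS n : W n = W n.+1 + W n.+1.
  by rewrite /W exprS; field; rewrite expf_neq0.
have LS n : L n = L n.+1 + L n.+1.
  by rewrite /L exprS; field; rewrite expf_neq0.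
pose inside n (p : R * R) :=
  [/\ a <= p.1, p.1 + W n <= b, c <= p.2 & p.2 + L n <= d].
pose T n (p : R * R) := rectint p.1 (p.1 + W n) p.2 (p.2 + L n) h.
pose bad n p := inside n p /\ e * (W n + L n) ^+ 2 < cabs (T n p).
(* The implication sits under the existential so that [cid] yields a successor for every pair, bad
   or not. *)
have step n p : exists q : R * R, bad n p ->
    [/\ bad n.+1 q, q.1 = p.1 \/ q.1 = p.1 + W n.+1 &
        q.2 = p.2 \/ q.2 = p.2 + L n.+1].
  have [[[pa pb pc pd] bp]|nb] := pselect (bad n p); last by exists p.
  set x := p.1 in pa pb bp *; set y := p.2 in pc pd bp *.
  have WS1 := W0 n.+1; have LS1 := L0 n.+1; have WSn := WS n; have LSn := LS n.
  have E : T n p = T n.+1 (x, y) + T n.+1 (x, y + L n.+1) +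
      (T n.+1 (x + W n.+1, y) + T n.+1 (x + W n.+1, y + L n.+1)).
    rewrite /T /= -/x -/y WSn LSn !(addrA _ (W _)) !(addrA _ (L _)).
    rewrite rectint_quarters// => u v /andP[? ?] /andP[? ?].
    by apply/cdiff_ccont/dh; apply/andP; split;
      [exact: le_trans pa _|apply: le_trans pb; rewrite WSn addrA
      |exact: le_trans pc _|apply: le_trans pd; rewrite LSn addrA].
  apply: contrapT => nex.
  have H q : ~ (bad n p -> [/\ bad n.+1 q, q.1 = x \/ q.1 = x + W n.+1 &
      q.2 = y \/ q.2 = y + L n.+1]) by move=> hq; apply: nex; exists q.
  have small q : q.1 = x \/ q.1 = x + W n.+1 -> q.2 = y \/ q.2 = y + L n.+1 ->
      cabs (T n.+1 q) <= e * (W n.+1 + L n.+1) ^+ 2.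
    move=> q1 q2; rewrite leNgt; apply/negP => bq; apply: (H q) => _; split=> //.
    by split=> //; split; clear - pa pb pc pd WSn LSn WS1 LS1 q1 q2; lra.
  have S1 := small (x, y) (or_introl erefl) (or_introl erefl).
  have S2 := small (x, y + L n.+1) (or_introl erefl) (or_intror erefl).
  have S3 := small (x + W n.+1, y) (or_intror erefl) (or_introl erefl).
  have S4 := small (x + W n.+1, y + L n.+1) (or_intror erefl) (or_intror erefl).
  move: bp; rewrite E ltNge => /negP; apply.
  rewrite (le_trans (cabsD _ _))//.
  rewrite (le_trans (lerD (cabsD _ _) (cabsD _ _)))//.
  (* The threshold scales by 4 under halving, exactly the number of quarters, so not all four can be
     small. *)
  have -> : (W n + L n) ^+ 2 = 4 * (W n.+1 + L n.+1) ^+ 2.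
    by rewrite WS LS; ring.
  rewrite mulrCA; move: (e * _) S1 S2 S3 S4 => K S1 S2 S3 S4.
  move: (cabs _) (cabs _) (cabs _) (cabs _) S1 S2 S3 S4.
  by clear => c1 c2 c3 c4 *; lra.
have bad0 : bad 0%N (a, c).
  rewrite /bad /inside /T /= /W /L expr0 !divr1 /w /l; split; first by split; lra.
  have -> : a + (b - a) = b by ring.
  have -> : c + (d - c) = d by ring.
  apply: le_lt_trans big.
  rewrite /e mulrAC ler_pdivrMr// ler_wpM2l ?(ltW e0'0)//.
  by rewrite /w /l lerDr.
pose nxt (np : nat * (R * R)) := (np.1.+1, projT1 (cid (step np.1 np.2))).
pose sq n := iter n nxt (0%N, (a, c)).
have sq1 n : (sq n).1 = n by elim: n => [//|n IH]; rewrite /sq iterS -/(sq n) /= IH.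
have sqP n : bad n (sq n).2.
  elim: n => [//|n IH]; rewrite /sq iterS -/(sq n) /nxt /=.
  case: cid => q /=; rewrite sq1 => Hq.
  by have [] := Hq IH.
have sqS n : ((sq n.+1).2.1 = (sq n).2.1 \/ (sq n.+1).2.1 = (sq n).2.1 + W n.+1) /\
    ((sq n.+1).2.2 = (sq n).2.2 \/ (sq n.+1).2.2 = (sq n).2.2 + L n.+1).
  rewrite /sq iterS -/(sq n) /nxt /=.
  case: cid => q /=; rewrite sq1 => Hq.
  by have [_ ? ?] := Hq (sqP n).
have [x Hx] : exists x, forall n, (sq n).2.1 <= x <= (sq n).2.1 + W n.
  apply: halving_intervals => // n; have [sx _] := sqS n.
  have := WS n; have := W0 n.+1; rewrite -/(W n) -/(W n.+1); lra.
have [y Hy] : exists y, forall n, (sq n).2.2 <= y <= (sq n).2.2 + L n.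
  apply: halving_intervals => // n; have [_ sx] := sqS n.
  have := LS n; have := L0 n.+1; rewrite -/(L n) -/(L n.+1); lra.
have [A HA] : cdiff h (Complex x y).
  have [[i1 i2 i3 i4] _] := sqP 0%N.
  have /andP[x1 x2] := Hx 0%N; have /andP[y1 y2] := Hy 0%N.
  apply: dh; first by rewrite (le_trans i1 x1) (le_trans x2 i2).
  by rewrite (le_trans i3 y1) (le_trans y2 i4).
have [r [r0 Hr]] := HA (e / 8) (divr_gt0 e0 (ltr0n _ 8)).
have [n nP] : exists n, W n + L n < r.
  have [n Hn] : exists n, (w + l) / r < 2 ^+ n.
    exists (Num.bound ((w + l) / r)).
    have := archi_boundP (divr_ge0 (addr_ge0 w0 l0) (ltW r0)).
    by move/lt_trans; apply; rewrite -natrX ltr_nat ltn_expl.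
  by exists n; rewrite /W /L -mulrDl ltr_pdivrMr ?exprn_gt0// mulrC -ltr_pdivrMr.
have [[i1 i2 i3 i4]] := sqP n; have := Hx n; have := Hy n.
set p := (sq n).2 in i1 i2 i3 i4 * => Hyn Hxn.
have Wn := W0 n; have Ln := L0 n.
rewrite ltNge => /negP; apply; rewrite /T.
set z := Complex x y in HA Hr.
(* Removing the affine part leaves the integral unchanged and makes the integrand at most (e / 8) (W
   n + L n). The factor 4 of [rectint_le] turns this into (e / 2) (W n + L n)^2, below the
   threshold. *)
pose g u := h u - ((h z - A * z) + A * u).
have ct : bdcont p.1 (p.1 + W n) p.2 (p.2 + L n) h.
  apply: bdcontP => [||u v H H0 _]; rewrite ?lerDl//.
  by apply/cdiff_ccont/dh; clear - i1 i2 i3 i4 H H0; lra.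
have ca : bdcont p.1 (p.1 + W n) p.2 (p.2 + L n) (fun u => (h z - A * z) + A * u).
  apply: bdcontP => [||u v _ _ _]; rewrite ?lerDl//; apply/cdiff_ccont.
  apply: cdiffD; first exact: cdiff_cst.
  apply: cdiffM; first exact: cdiff_cst.
  exact: cdiff_id.
have -> : rectint p.1 (p.1 + W n) p.2 (p.2 + L n) h =
    rectint p.1 (p.1 + W n) p.2 (p.2 + L n) g.
  by rewrite rectintB// rectint_affine ?subr0// lerDl.
have Bnd : forall u v, p.1 <= u <= p.1 + W n -> p.2 <= v <= p.2 + L n ->
    cabs (g (Complex u v)) <= e / 8 * (W n + L n).
  move=> u v Hu Hv.
  have dz : cabs (Complex u v - z) <= W n + L n.
    rewrite (le_trans (cabs_le_ReIm _))//; clear - Hu Hv Hxn Hyn.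
    by apply: lerD; rewrite ler_norml !ReImE /=; lra.
  have -> : g (Complex u v) = h (z + (Complex u v - z)) - h z - A * (Complex u v - z).
    by rewrite /g [z + _]addrC subrK; ring.
  rewrite (le_trans (Hr _ (le_lt_trans dz nP)))// ler_wpM2l//; lra.
rewrite (le_trans (@rectint_le _ _ _ _ _ (e / 8 * (W n + L n)) _ _ _ _))//; try lra.
- exact: bdcontB.
- by move=> u v ? ? _; exact: Bnd.
have -> : p.1 + W n - p.1 + (p.2 + L n - p.2) = W n + L n by ring.
have : 0 <= e * (W n + L n) ^+ 2 by rewrite mulr_ge0 ?sqr_ge0 ?ltW.
rewrite expr2; lra.
Qed.

End Goursat.

(** * Cauchy's integral formula on a square *)

Section Cauchy.
Variable R : realType.
Implicit Types (h f : R[i] -> R[i]) (x y : R).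

(** The frame between the two rectangles is cut into two strips of full height and two shorter ones
    between them; [goursat] annihilates all four. *)
Lemma rectint_nested (a a' b' b c c' d' d : R) h :
  a <= a' -> a' <= b' -> b' <= b -> c <= c' -> c' <= d' -> d' <= d ->
  (forall x y, a <= x <= b -> c <= y <= d ->
     x <= a' \/ b' <= x \/ y <= c' \/ d' <= y -> cdiff h (Complex x y)) ->
  rectint a b c d h = rectint a' b' c' d' h.
Proof.
move=> aa ab bb cc cd dd H.
have cont x y : a <= x <= b -> c <= y <= d ->
     x <= a' \/ b' <= x \/ y <= c' \/ d' <= y -> ccont h (Complex x y).
  by move=> *; apply: cdiff_ccont; exact: H.
have hor u v t : a <= u -> v <= b -> c <= t <= d ->
    v <= a' \/ b' <= u \/ t <= c' \/ d' <= t -> icont u v (fun s => h (Complex s t)).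
  by move=> au vb td E; apply: icont_hor => s sd; apply: cont => //; lra.
have ver u v t : c <= u -> v <= d -> a <= t <= b ->
    t <= a' \/ b' <= t \/ v <= c' \/ d' <= u -> icont u v (fun s => h (Complex t s)).
  by move=> au vb td E; apply: icont_ver => s sd; apply: cont => //; lra.
rewrite (@rectint_splitx _ a a' b); [|lra| |]; first last.
- by apply: ver; lra.
- by split; [apply: hor|apply: hor|apply: ver|apply: ver]; lra.
rewrite goursat ?add0r; [|lra|lra|by move=> *; apply: H; lra].
rewrite (@rectint_splitx _ a' b' b); [|lra| |]; first last.
- by apply: ver; lra.
- by split; [apply: hor|apply: hor|apply: ver|apply: ver]; lra.
rewrite [X in _ + X]goursat ?addr0; [|lra|lra|by move=> *; apply: H; lra].
rewrite (@rectint_splity _ a' b' c c' d); [|lra| |]; first last.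
- by apply: hor; lra.
- by split; [apply: hor|apply: hor|apply: ver|apply: ver]; lra.
rewrite goursat ?add0r; [|lra|lra|by move=> *; apply: H; lra].
rewrite (@rectint_splity _ a' b' c' d' d); [|lra| |]; first last.
- by apply: hor; lra.
- by split; [apply: hor|apply: hor|apply: ver|apply: ver]; lra.
by rewrite [X in _ + X]goursat ?addr0; [|lra|lra|by move=> *; apply: H; lra].
Qed.

Lemma complex_neq x y x' y' : x != x' \/ y != y' -> Complex x y != Complex x' y'.
Proof. by rewrite eq_complex negb_and /= => /orP. Qed.

Lemma abs_lt_eq0 (r : R) : (forall e, 0 < e -> `|r| <= e) -> r = 0.
Proof.
move=> H; apply/eqP; rewrite -normr_le0; apply/ler_addgt0Pr => e e0.
by rewrite add0r H.
Qed.

Lemma cabs_lt_eq0 (z : R[i]) : (forall e, 0 < e -> cabs z <= e) -> z = 0.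
Proof.
move=> H; apply/eqP; rewrite -cabs_eq0; apply/eqP/abs_lt_eq0 => e e0.
by rewrite ger0_norm ?cabs_ge0// H.
Qed.

Definition sqint h := rectint (-1) 1 (-1) 1 h.
Definition sqcont h := bdcont (-1) 1 (-1) 1 h.
Definition in_sq (z : R[i]) := (-1 <= complex.Re z <= 1) && (-1 <= complex.Im z <= 1).

Lemma eq_sqint f h : (forall x y, -1 <= x <= 1 -> -1 <= y <= 1 ->
    x = -1 \/ x = 1 \/ y = -1 \/ y = 1 -> f (Complex x y) = h (Complex x y)) ->
  sqint f = sqint h.
Proof.
move=> fh; have o1 : -1 <= (1 : R) <= 1 by lra.
have o2 : -1 <= (-1 : R) <= 1 by lra.
rewrite /sqint /rectint; congr (_ + 'i%C * _); apply: eq_cint => t tb;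
  congr (_ - _); apply: fh => //; tauto.
Qed.

(* The integrand is O(L^-2) on the square of half-side L, to which the contour
   can be moved. *)
Lemma sqint_kernel_diff (x : R) : `|x| <= 2^-1 ->
  sqint (fun z => x%:C%C * ((z - x%:C%C)^-1 * z^-1)) = 0.
Proof.
move=> x2; have /andP[x2l x2r] : - 2^-1 <= x <= 2^-1 by rewrite -ler_norml.
apply: cabs_lt_eq0 => e e0.
(* With the integrand at most 2 / L^2 on the enlarged square, [rectint_le] gives 4 (2 / L^2) (4 L) =
   32 / L. *)
pose L := Num.max 1 (32 / e).
have L1 : 1 <= L by rewrite le_max lexx.
have L0 : 0 < L by rewrite (lt_le_trans ltr01).
have Le : 32 / e <= L by rewrite le_max lexx orbT.
have nz (u v : R) : - L <= u <= L -> - L <= v <= L ->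
    u <= -1 \/ 1 <= u \/ v <= -1 \/ 1 <= v ->
    Complex u v != 0 /\ Complex u v != x%:C%C.
  move=> _ _ H; split; [apply: (@complex_neq _ _ 0 0)|apply: complex_neq].
    by have [E|] := eqVneq u 0; [right; apply/eqP => v0; lra|left].
  by have [E|] := eqVneq u x; [right; apply/eqP => v0; lra|left].
have dif (u v : R) : - L <= u <= L -> - L <= v <= L ->
    u <= -1 \/ 1 <= u \/ v <= -1 \/ 1 <= v ->
    cdiff (fun z => x%:C%C * ((z - x%:C%C)^-1 * z^-1)) (Complex u v).
  move=> uL vL H; have [n0 nx] := nz u v uL vL H.
  apply: cdiffM; first exact: cdiff_cst.
  apply: cdiffM; first exact: cdiff_inv.
  apply: eq_cdiff (cdiff_inv n0) => z; by rewrite subr0.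
rewrite /sqint -(@rectint_nested (- L) (-1) 1 L (- L) (-1) 1 L) //; try lra.
rewrite (le_trans (@rectint_le _ _ _ _ _ _ (2 / L ^+ 2) _ _ _ _))//; try lra.
- by apply: bdcontP; try lra; move=> u v uL vL H; apply/cdiff_ccont/dif; lra.
- move=> u v uL vL H; have [|n0 nx] := nz u v uL vL; first lra.
  rewrite !cabsM !cabsV cabs_real.
  have h1 : L <= cabs (Complex u v).
    have := Re_le_cabs (Complex u v); have := Im_le_cabs (Complex u v).
    by rewrite /= !ler_norml; lra.
  have h2 : L / 2 <= cabs (Complex u v - x%:C%C).
    have := cabsD (Complex u v - x%:C%C) x%:C%C.
    by rewrite subrK cabs_real; lra.
  have p1 : 0 < cabs (Complex u v) by lra.
  have p2 : 0 < cabs (Complex u v - x%:C%C) by lra.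
  rewrite -invfM ler_pdivrMr ?mulr_gt0// mulrAC ler_pdivlMr ?exprn_gt0//.
  have : L / 2 * L <= cabs (Complex u v - x%:C%C) * cabs (Complex u v).
    by apply: ler_pM => //; lra.
  have : `|x| * L ^+ 2 <= 2^-1 * L ^+ 2 by rewrite ler_wpM2r ?sqr_ge0.
  rewrite !expr2; have := mulr_gt0 L0 L0; lra.
have -> : 4 * (2 / L ^+ 2) * (L - - L + (L - - L)) = 32 / L.
  by field; rewrite gt_eqF.
by rewrite ler_pdivrMr// mulrC -ler_pdivrMr.
Qed.

Lemma in_sqP x y : in_sq (Complex x y) = (-1 <= x <= 1) && (-1 <= y <= 1).
Proof. by []. Qed.

Lemma bd_sq x y : -1 <= x <= 1 -> -1 <= y <= 1 ->
  x = -1 \/ x = 1 \/ y = -1 \/ y = 1 -> forall p : R, `|p| < 1 ->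
  Complex x y != p%:C%C.
Proof.
move=> _ _ H p; rewrite ltr_norml => p1; apply: complex_neq.
by have [E|] := eqVneq x p; [right; apply/eqP => v0; lra|left].
Qed.

Lemma sqcont_cdiff f : (forall z, in_sq z -> cdiff f z) -> sqcont f.
Proof.
move=> df; apply: bdcontP; [lra|lra|move=> x y xb yb _].
by apply/cdiff_ccont/df; rewrite in_sqP xb yb.
Qed.

Lemma sqcontM_kernel f (p : R) : `|p| < 1 -> (forall z, in_sq z -> cdiff f z) ->
  sqcont (fun z => f z * (z - p%:C%C)^-1).
Proof.
move=> p1 df; apply: bdcontP; [lra|lra|move=> x y xb yb H].
apply: cdiff_ccont; apply: cdiffM; first by apply: df; rewrite in_sqP xb yb.
by apply: cdiff_inv; exact: bd_sq.
Qed.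

Lemma sqcont_kernel (p : R) : `|p| < 1 -> sqcont (fun z => (z - p%:C%C)^-1).
Proof.
move=> p1; have := @sqcontM_kernel (fun=> 1) p p1 (fun z _ => cdiff_cst 1 z).
by congr bdcont; apply/funext => z; rewrite mul1r.
Qed.

(* This is 2 i pi; only its independence of the pole and a lower bound are needed. *)
Definition kappa := sqint (fun z : R[i] => (z - 0%:C%C)^-1).

(** The partial fraction 1 / (z - p) - 1 / z = p / ((z - p) z) reduces the claim to
    [sqint_kernel_diff]. *)
Lemma sqint_kernel (p : R) : `|p| <= 2^-1 ->
  sqint (fun z => (z - p%:C%C)^-1) = kappa.
Proof.
move=> p2; have p1 : `|p| < 1 by lra.
have z1 : `|0 : R| < 1 by rewrite normr0.
apply/eqP; rewrite -subr_eq0 /kappa {1 2}/sqint -rectintB; try exact: sqcont_kernel.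
apply/eqP; rewrite -[RHS](sqint_kernel_diff p2).
apply: eq_sqint => x y xb yb H.
have n0 := bd_sq xb yb H z1; have np := bd_sq xb yb H p1.
have n1 : Complex x y != 0 := n0.
rewrite [0%:C%C](_ : _ = 0)// subr0; field.
by rewrite n1 subr_eq0 np.
Qed.

Lemma kappa_ge : 4 <= cabs kappa.
Proof.
apply: le_trans (Im_le_cabs _); apply: le_trans (ler_norm _).
have z1 : `|0 : R| < 1 by rewrite normr0.
have [k1 k2 k3 k4] := sqcont_kernel z1.
have iB := icontB k1 k2; have iB' := icontB k4 k3.
rewrite /kappa /sqint /rectint !ReImE /= mul0r add0r mul1r.
have m0 (t : R) : 0 < t ^+ 2 + 1 by rewrite ltr_wpDl ?sqr_ge0.
have key (u : R -> R) : lebesgue_measure.-integrable `[(-1 : R), 1] (EFin \o u) ->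
    (forall t : R, -1 <= t <= 1 -> u t = 2 / (t ^+ 2 + 1)) ->
    2 <= \int[lebesgue_measure]_(t in `[(-1), 1]) u t.
  move=> iu uE; have <- : \int[lebesgue_measure]_(t in `[(-1 : R), 1]) 1 = 2.
    by rewrite Rint_cst; [ring|lra].
  apply: le_Rintegral => //; first exact: (icont_Re (@icont_cst R (-1) 1 1)).
  move=> t; rewrite /= in_itv/= => tb; rewrite uE// ler_pdivlMr// mul1r.
  have : 0 <= (1 - t) * (1 + t) by apply: mulr_ge0; lra.
  rewrite expr2; lra.
rewrite [leLHS](_ : 4 = 2 + 2)%R; last by ring.
apply: lerD; apply: key.
- exact: icont_Im iB.
- move=> t _; rewrite ?ReImE /= ?subr0; field.
  by rewrite gt_eqF//.
- exact: icont_Re iB'.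
- move=> t _; rewrite ?ReImE /= ?subr0; field.
  by rewrite gt_eqF//.
Qed.

(** After subtracting the constant f(p), what remains is the integral of the difference quotient
    [q]. It is bounded near the pole, so shrinking the contour to a small square around the pole
    makes the integral arbitrarily small. *)
Lemma cauchy f (p : R) : `|p| <= 2^-1 -> (forall z, in_sq z -> cdiff f z) ->
  sqint (fun z => f z * (z - p%:C%C)^-1) = kappa * f p%:C%C.
Proof.
move=> p2 df; have p1 : `|p| < 1 by lra.
set P := p%:C%C; apply/eqP; rewrite -subr_eq0 mulrC -(sqint_kernel p2).
rewrite /sqint -rectintZ; last exact: sqcont_kernel.
have cq := sqcontM_kernel p1 df.
have cf : sqcont (fun z => f P * (z - P)^-1) by apply: bdcontZ; exact: sqcont_kernel.
rewrite -rectintB//; apply/eqP/cabs_lt_eq0 => e e0.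
pose q z := (f z - f P) * (z - P)^-1.
rewrite (_ : (fun z => _) = q); last by apply/funext => z; rewrite /q mulrBl.
have dq z : in_sq z -> z != P -> cdiff q z.
  move=> zs zP; apply: cdiffM; last exact: cdiff_inv.
  by apply: cdiffD; [exact: df|exact: cdiff_cst].
have [A HA] : cdiff f P.
  by apply: df; rewrite in_sqP; move: p2; rewrite ler_norml; lra.
have [d [d0 Hd]] := HA 1 ltr01.
pose M := 1 + cabs A.
have M1 : 1 <= M by rewrite lerDl cabs_ge0.
have M0 : 0 < M by rewrite (lt_le_trans ltr01).
(* The first bound keeps the small square inside the unit one, the second keeps its boundary within
   [d] of the pole, and the third absorbs the estimate 4 M (2 r + 2 r) = 16 M r. *)
pose r := Num.min (Num.min (4^-1) (d / 4)) (e / (16 * M)).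
have M160 : 0 < 16 * M by rewrite mulr_gt0.
have r0 : 0 < r by rewrite !lt_min invr_gt0 ltr0n/= (divr_gt0 d0)// (divr_gt0 e0).
have r4 : r <= 4^-1 by rewrite !ge_min lexx.
have rd : r <= d / 4 by rewrite !ge_min lexx orbT.
have re : r <= e / (16 * M) by rewrite !ge_min lexx !orbT.
have /andP[pl pr] : - 2^-1 <= p <= 2^-1 by rewrite -ler_norml.
rewrite (@rectint_nested (-1) (p - r) (p + r) 1 (-1) (- r) r 1); try lra; last first.
  move=> x y xb yb H; apply: dq; first by rewrite in_sqP xb yb.
  apply: complex_neq.
  by have [E|] := eqVneq x p; [right; apply/eqP => v0; lra|left].
have nP x y : x = p - r \/ x = p + r \/ y = - r \/ y = r -> Complex x y != P.
  move=> H; apply: complex_neq.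
  by have [E|] := eqVneq x p; [right; apply/eqP => v0; lra|left].
rewrite (le_trans (@rectint_le _ _ _ _ _ _ M _ _ _ _))//; try lra.
- apply: bdcontP => [||x y xb yb H]; [lra|lra|apply/cdiff_ccont/dq; last exact: nP].
  by rewrite in_sqP; lra.
- move=> x y xb yb H; have zP := nP x y H.
  have dz : cabs (Complex x y - P) < d.
    rewrite (le_lt_trans (cabs_le_ReIm _))// !ReImE /= subr0.
    have h1 : `|x - p| <= r by rewrite ler_norml; lra.
    have h2 : `|y| <= r by rewrite ler_norml; lra.
    lra.
  have u0 : 0 < cabs (Complex x y - P) by rewrite cabs_gt0// subr_eq0.
  rewrite /q cabsM cabsV ler_pdivrMr//.
  have -> : f (Complex x y) - f P =
    (f (P + (Complex x y - P)) - f P - A * (Complex x y - P)) + A * (Complex x y - P).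
    by rewrite [P + _]addrC !subrK.
  by rewrite (le_trans (cabsD _ _))// cabsM /M mulrDl lerD// Hd.
have -> : 4 * M * (p + r - (p - r) + (r - - r)) = r * (16 * M) by ring.
by rewrite -ler_pdivlMr// mulr_gt0.
Qed.

End Cauchy.

(** * Newton interpolation of holomorphic functions *)

Section Newton.
Variable R : realType.
Implicit Types (f u : R[i] -> R[i]) (x : R) (s : seq (R * R)).

(** One infinite sequence of distinct points serves divided differences of every order. *)
Definition node (i : nat) : R := (5 * i.+1%:R)^-1.

Lemma node_inj : injective node.
Proof.
move=> i j /invr_inj /mulfI H; apply: succn_inj; apply/eqP.
by rewrite -(eqr_nat R) H.
Qed.

Lemma node_ge0 i : 0 <= node i.
Proof. by rewrite invr_ge0 mulr_ge0. Qed.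

Lemma node_le i : node i <= 5^-1.
Proof.
by rewrite lef_pV2 ?posrE ?mulr_gt0 ?ltr0n// ler_peMr// ler1n.
Qed.

Definition lincomb s (u : R -> R[i]) := \sum_(p <- s) p.1%:C%C * u p.2.
Definition scale (c : R) s := [seq (c * p.1, p.2) | p <- s].

Lemma lincomb_cat s1 s2 (u : R -> R[i]) :
  lincomb (s1 ++ s2) u = lincomb s1 u + lincomb s2 u.
Proof. by rewrite /lincomb big_cat. Qed.

Lemma lincomb_scale (c : R) s (u : R -> R[i]) :
  lincomb (scale c s) u = c%:C%C * lincomb s u.
Proof.
rewrite /lincomb big_map mulr_sumr; apply: eq_bigr => p _.
by rewrite rmorphM/= mulrA.
Qed.

(* The divided difference at the nodes i, ..., i + k, as a formal combination
   (coefficient, node) that can be evaluated on functions of any kind. *)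
Fixpoint ddiff (k i : nat) : seq (R * R) :=
  if k is k'.+1 then
    let c := (node (i + k) - node i)^-1 in
    scale c (ddiff k' i.+1) ++ scale (- c) (ddiff k' i)
  else [:: (1, node i)].

Definition small_nodes s := all (fun p : R * R => (0 <= p.2) && (p.2 <= 5^-1)) s.

Lemma small_nodes_scale (c : R) s : small_nodes (scale c s) = small_nodes s.
Proof. by rewrite /small_nodes all_map; apply: eq_all. Qed.

Lemma small_nodes_ddiff k i : small_nodes (ddiff k i).
Proof.
elim: k i => [|k IH] i; first by rewrite /small_nodes/= node_ge0 node_le.
by rewrite /small_nodes all_cat; apply/andP; split;
  rewrite -/(small_nodes _) small_nodes_scale IH.
Qed.

Definition ker (z : R[i]) x := (z - x%:C%C)^-1.

(** The two divided differences of lower order are the full product times z minus its first node and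
    times z minus its last node; subtracting them leaves the difference of the nodes, which the
    recursion divides out. *)
Lemma ddiff_ker (z : R[i]) k i : (forall l, z != (node l)%:C%C) ->
  lincomb (ddiff k i) (ker z) = \prod_(l < k.+1) ker z (node (i + l)).
Proof.
move=> zn; elim: k i => [|k IH] i.
  by rewrite /lincomb big_seq1/= big_ord1 addn0 mul1r.
rewrite [ddiff _ _]/= lincomb_cat !lincomb_scale !IH.
have xi : node (i + k.+1) - node i != 0.
  by rewrite subr_eq0 (inj_eq node_inj) -[X in _ == X]addn0 eqn_add2l.
have zl l : z - (node l)%:C%C != 0 by rewrite subr_eq0.
set F := RHS.
have E1 : \prod_(l < k.+1) ker z (node (i.+1 + l)) = (z - (node i)%:C%C) * F.
  rewrite /F [in RHS]big_ord_recl addn0 [ker z (node i)]/ker mulVKf//.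
  by apply: eq_bigr => l _; rewrite addSnnS.
have E2 : \prod_(l < k.+1) ker z (node (i + l)) = (z - (node (i + k.+1))%:C%C) * F.
  by rewrite /F [in RHS]big_ord_recr/= mulrCA [ker z (node (i + k.+1))]/ker mulfV// mulr1.
rewrite E1 E2 rmorphN/= -[_^-1%:C%C]/(real_complex R _) fmorphV rmorphB/=.
have xi' : (node (i + k.+1))%:C%C - (node i)%:C%C != 0 :> R[i].
  by rewrite -rmorphB/= fmorph_eq0.
by field.
Qed.

(* The powers of 4/5 and 5/4 balance the two factors so that the functionals are
   bounded uniformly in k and the monomials by 2^-k. *)
Definition newton_coef (k : nat) := scale ((4 / 5) ^+ k) (ddiff k 0).
Definition newton_mon (k : nat) x : R := \prod_(l < k) (5 / 4 * (x - node l)).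

Lemma newton_ker (z : R[i]) k : (forall l, z != (node l)%:C%C) ->
  lincomb (newton_coef k) (ker z) = ((4 / 5) ^+ k)%:C%C * \prod_(l < k.+1) ker z (node l).
Proof. by move=> zn; rewrite lincomb_scale ddiff_ker. Qed.

Lemma newton_mon_le k x : `|x| <= 5^-1 -> `|newton_mon k x| <= 2^-1 ^+ k.
Proof.
move=> x5; rewrite /newton_mon normr_prod -[k in leRHS]card_ord -prodr_const.
apply: ler_prod => l _; rewrite normr_ge0/= normrM.
have := node_ge0 l; have := node_le l => h1 h2.
have : `|x - node l| <= 2 / 5 by move: x5; rewrite !ler_norml; lra.
have -> : `|5 / 4 : R| = 5 / 4 by rewrite ger0_norm//; lra.
lra.
Qed.

(** For the Cauchy kernel the remainder is explicit: passing from N to N + 1 uses 1 / (z - x) - 1 /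
    (z - y) = (x - y) / ((z - x) (z - y)) with y the next node. *)
Lemma newton_ker_rem (z : R[i]) x N : (forall l, z != (node l)%:C%C) -> z != x%:C%C ->
  ker z x - \sum_(k < N) (newton_mon k x)%:C%C * lincomb (newton_coef k) (ker z) =
  (newton_mon N x * (4 / 5) ^+ N)%:C%C * (\prod_(l < N) ker z (node l)) * ker z x.
Proof.
move=> zn zx; elim: N => [|N IH].
  by rewrite /newton_mon !big_ord0 subr0 expr0 !mul1r.
have E : newton_mon N.+1 x * (4 / 5) ^+ N.+1 =
    newton_mon N x * (4 / 5) ^+ N * (x - node N).
  by rewrite /newton_mon big_ord_recr/= exprS; field.
rewrite big_ord_recr/= opprD addrA IH newton_ker// !big_ord_recr/= E.
rewrite !rmorphM/= rmorphB/=.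
have zl l : z - (node l)%:C%C != 0 by rewrite subr_eq0.
have zx' : z - x%:C%C != 0 by rewrite subr_eq0.
rewrite /ker; field.
by rewrite zl zx'.
Qed.

Lemma small_abs_half x : (0 <= x) && (x <= 5^-1) -> `|x| <= 2^-1.
Proof. by rewrite ler_norml; lra. Qed.

(** By linearity, a combination of point evaluations of [f] is represented by the same combination
    of kernels. *)
Lemma lincomb_cauchy s f : all (fun p => `|p.2| <= 2^-1) s ->
  (forall z, in_sq z -> cdiff f z) ->
  sqcont (fun z => f z * lincomb s (ker z)) /\
  sqint (fun z => f z * lincomb s (ker z)) = kappa R * lincomb s (fun x => f x%:C%C).
Proof.
move=> + df; elim: s => [_|p s IH /= /andP[p2 /IH [cs Es]]].
  (* The zero integrand is put in affine form for [rectint_affine]. *)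
  rewrite (_ : (fun z => _) = fun z => 0 + 0 * z); last first.
    by apply/funext => z; rewrite /lincomb big_nil mulr0 mul0r addr0.
  rewrite /sqint rectint_affine; [|lra|lra]; split.
    apply: sqcont_cdiff => z _; apply: cdiffD; first exact: cdiff_cst.
    by apply: cdiffM; [exact: cdiff_cst|exact: cdiff_id].
  by rewrite /lincomb big_nil mulr0.
have -> : (fun z => f z * lincomb (p :: s) (ker z)) =
    (fun z => p.1%:C%C * (f z * (z - p.2%:C%C)^-1) + f z * lincomb s (ker z)).
  by apply/funext => z; rewrite /lincomb big_cons mulrDr mulrCA.
have c1 := @sqcontM_kernel R f p.2 (le_lt_trans p2 _) df.
have {}c1 : sqcont (fun z => f z / (z - (p.2)%:C%C)) by apply: c1; lra.
have c2 : sqcont (fun z => p.1%:C%C * (f z / (z - (p.2)%:C%C))) by exact: bdcontZ.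
split; first exact: bdcontD.
rewrite /sqint rectintD// rectintZ//.
rewrite -/(sqint (fun z => f z / (z - (p.2)%:C%C))).
rewrite -/(sqint (fun z => f z * lincomb s (ker z))) cauchy// Es.
by rewrite /lincomb big_cons; ring.
Qed.

Definition on_bd (z : R[i]) := in_sq z /\
  (complex.Re z = -1 \/ complex.Re z = 1 \/ complex.Im z = -1 \/ complex.Im z = 1).

(** Transfers a bound for kernels on the contour to all holomorphic [f]. The constant 4 is 16, from
    [rectint_le] on the unit square, divided by the lower bound 4 for [kappa]. *)
Lemma lincomb_le s f (M B : R) : all (fun p => `|p.2| <= 2^-1) s ->
  (forall z, in_sq z -> cdiff f z) -> (forall z, in_sq z -> cabs (f z) <= M) ->
  (forall z, on_bd z -> cabs (lincomb s (ker z)) <= B) ->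
  cabs (lincomb s (fun x => f x%:C%C)) <= 4 * (M * B).
Proof.
move=> ss df fM sB; have [cs Es] := lincomb_cauchy ss df.
have : cabs (kappa R * lincomb s (fun x => f x%:C%C)) <= 16 * (M * B).
  have o1 : (-1 : R) <= 1 by lra.
  rewrite -Es; have -> : 16 * (M * B) = 4 * (M * B) * ((1 - -1) + (1 - -1)) by ring.
  apply: (rectint_le o1 o1 cs) => x y xb yb H; rewrite cabsM.
  have xy : in_sq (Complex x y) by rewrite in_sqP xb yb.
  by apply: ler_pM; rewrite ?cabs_ge0 ?fM// sB.
rewrite cabsM => H; have k4 := @kappa_ge R.
have : 4 * cabs (lincomb s (fun x => f x%:C%C)) <=
    cabs (kappa R) * cabs (lincomb s (fun x => f x%:C%C)).
  by rewrite ler_wpM2r ?cabs_ge0.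
by move: H; move: (_ * cabs (lincomb _ _)) => A H1 H2; lra.
Qed.

Lemma ker_bd (z : R[i]) x : on_bd z -> `|x| <= 5^-1 -> cabs (ker z x) <= 5 / 4 /\ z != x%:C%C.
Proof.
case: z => u v [_ H] x5.
have h : 4 / 5 <= cabs (Complex u v - x%:C%C).
  have := Re_le_cabs (Complex u v - x%:C%C).
  have := Im_le_cabs (Complex u v - x%:C%C).
  by move: H x5; rewrite !ReImE /= !ler_norml; lra.
split; last by rewrite -subr_eq0 -cabs_eq0 gt_eqF//; lra.
by rewrite /ker cabsV -[leRHS]invrK lef_pV2 ?posrE ?invfM ?invrK; lra.
Qed.

Lemma node_abs l : `|node l| <= 5^-1.
Proof. by rewrite ger0_norm ?node_ge0 ?node_le. Qed.

Lemma prod_ker_le (z : R[i]) k : on_bd z ->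
  cabs (\prod_(l < k) ker z (node l)) <= (5 / 4) ^+ k.
Proof.
move=> zb; elim: k => [|k IH]; first by rewrite big_ord0 cabs1 expr0.
rewrite big_ord_recr/= cabsM exprSr; apply: ler_pM; rewrite ?cabs_ge0//.
by case: (ker_bd zb (node_abs k)).
Qed.

Lemma small_half s : small_nodes s -> all (fun p => `|p.2| <= 2^-1) s.
Proof. by apply: sub_all => p; exact: small_abs_half. Qed.

Lemma small_newton k : small_nodes (newton_coef k).
Proof. by rewrite small_nodes_scale small_nodes_ddiff. Qed.

Lemma exp4554 k : (4 / 5) ^+ k * (5 / 4) ^+ k = 1 :> R.
Proof. by rewrite -exprMn (_ : 4 / 5 * (5 / 4) = 1) ?expr1n//; field. Qed.

(** The kernel product has k + 1 factors at most 5/4, of which the scaling cancels all but one; this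
    leaves 4 M (5/4). *)
Lemma newton_coef_le f (M : R) k :
  (forall z, in_sq z -> cdiff f z) -> (forall z, in_sq z -> cabs (f z) <= M) ->
  cabs (lincomb (newton_coef k) (fun x => f x%:C%C)) <= 5 * M.
Proof.
move=> df fM; have -> : 5 * M = 4 * (M * (5 / 4)) by field.
apply: lincomb_le => //; first exact/small_half/small_newton.
move=> z zb; rewrite newton_ker; last by move=> l; case: (ker_bd zb (node_abs l)).
have p45 : 0 <= (4 / 5) ^+ k :> R by rewrite exprn_ge0//; lra.
rewrite cabsM cabs_real ger0_norm// (le_trans (ler_wpM2l _ (prod_ker_le _ zb)))//.
by rewrite exprSr [leLHS]mulrA exp4554 mul1r.
Qed.

Lemma newton_rem_le f (M : R) N x : `|x| <= 5^-1 ->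
  (forall z, in_sq z -> cdiff f z) -> (forall z, in_sq z -> cabs (f z) <= M) ->
  cabs (f x%:C%C - \sum_(k < N) (newton_mon k x)%:C%C *
          lincomb (newton_coef k) (fun x => f x%:C%C)) <= 5 * M / 2 ^+ N.
Proof.
move=> x5 df fM.
(* The interpolation error at [x] is itself a formal combination of point evaluations, so
   [lincomb_le] applies to it through the closed form of the kernel remainder. *)
pose s := (1, x) :: flatten
  [seq scale (- newton_mon k x) (newton_coef k) | k <- iota 0 N].
have sE (u : R -> R[i]) : lincomb s u = u x -
    \sum_(k < N) (newton_mon k x)%:C%C * lincomb (newton_coef k) u.
  rewrite /lincomb big_cons mul1r big_flatten big_map /=; congr (_ + _).
  rewrite -sumrN -(big_mkord xpredT (fun k => - ((newton_mon k x)%:C%C *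
    \sum_(p <- newton_coef k) (p.1)%:C%C * u p.2))) /index_iota subn0.
  apply: eq_bigr => k _; rewrite -/(lincomb _ _) lincomb_scale -mulNr.
  by rewrite rmorphN.
rewrite -(sE (fun x => f x%:C%C)).
have -> : 5 * M / 2 ^+ N = 4 * (M * (5 / 4 / 2 ^+ N)) by field; rewrite expf_neq0.
apply: lincomb_le => //.
  apply/allP => p; rewrite in_cons => /orP[/eqP -> /=|]; first by lra.
  move=> /flatten_mapP[k _ pk].
  have : small_nodes (scale (- newton_mon k x) (newton_coef k)).
    by rewrite small_nodes_scale small_newton.
  by move/small_half/allP/(_ _ pk).
move=> z zb; have zn l : z != (node l)%:C%C by case: (ker_bd zb (node_abs l)).
have [kx zx] := ker_bd zb x5.
rewrite sE newton_ker_rem// !cabsM cabs_real normrM.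
have p45 : 0 <= (4 / 5) ^+ N :> R by rewrite exprn_ge0//; lra.
rewrite [X in _ * X * _ * _]ger0_norm//.
have E1 : (4 / 5) ^+ N * cabs (\prod_(l < N) ker z (node l)) <= 1.
  by rewrite -[leRHS](exp4554 N) ler_wpM2l// prod_ker_le.
rewrite -[X in X * _]mulrA [leRHS]mulrC; apply: ler_pM; rewrite ?cabs_ge0//.
  by rewrite !mulr_ge0// cabs_ge0.
rewrite -[leRHS]mulr1 -exprVn; apply: ler_pM => //; first by rewrite mulr_ge0 ?cabs_ge0.
exact: newton_mon_le.
Qed.

End Newton.

(** * Tensor products of one-variable Newton interpolation *)

Section MultivariateNewton.
Variable R : realType.
Implicit Types (phi : seq R[i] -> R[i]) (w : seq R) (al : seq nat).

Fixpoint mcoef al : seq (R * seq R) :=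
  if al is k :: al' then
    [seq (p.1 * q.1, p.2 :: q.2) | p <- newton_coef R k, q <- mcoef al']
  else [:: (1, [::])].

Fixpoint mmon al w : R :=
  match al, w with
  | k :: al', x :: w' => newton_mon k x * mmon al' w'
  | _, _ => 1
  end.

(** The multi-indices of length m with all entries below N. *)
Fixpoint words (N m : nat) : seq (seq nat) :=
  if m is m'.+1 then [seq k :: al | k <- iota 0 N, al <- words N m']
  else [:: [::]].

Lemma size_words N m : size (words N m) = (N ^ m)%N.
Proof. by elim: m => [//|m IH]; rewrite size_allpairs IH size_iota expnS. Qed.

Lemma size_in_words N m al : al \in words N m -> size al = m.
Proof.
elim: m al => [|m IH] al; first by rewrite inE => /eqP ->.
by move=> /allpairsPdep[k [be [_ /IH <- ->]]].
Qed.

Definition creals w : seq R[i] := [seq x%:C%C | x <- w].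

Definition mlincomb al (u : seq R -> R[i]) := \sum_(p <- mcoef al) p.1%:C%C * u p.2.

(** Contracts the first variable by the k-th Newton functional; the inductions on the number of
    variables pass through it. *)
Definition slice k phi (z : seq R[i]) :=
  lincomb (newton_coef R k) (fun x => phi (x%:C%C :: z)).

Lemma mlincomb_cons k al phi :
  mlincomb (k :: al) (phi \o creals) = mlincomb al (slice k phi \o creals).
Proof.
rewrite /mlincomb [mcoef (k :: al)]/= big_allpairs_dep exchange_big /=.
apply: eq_bigr => q _; rewrite /slice /lincomb mulr_sumr; apply: eq_bigr => p _.
by rewrite rmorphM/= mulrAC mulrC mulrA.
Qed.

(** Holomorphy in each variable separately, the others being frozen in the square; this is the form
    in which the one-variable estimates are iterated. *)
Definition sepdiff m phi := forall s1 s2 z, (size s1 + size s2).+1 = m ->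
  all (@in_sq R) s1 -> all (@in_sq R) s2 -> in_sq z ->
  cdiff (fun y => phi (s1 ++ y :: s2)) z.

Definition bounded_sq m phi (M : R) := forall s, size s = m -> all (@in_sq R) s ->
  cabs (phi s) <= M.

Lemma in_sq_real (x : R) : `|x| <= 5^-1 -> in_sq x%:C%C.
Proof. by rewrite ler_norml /in_sq /=; lra. Qed.

Lemma cdiff_lincomb s (F : R -> R[i] -> R[i]) z :
  (forall p, p \in s -> cdiff (F p.2) z) ->
  cdiff (fun y => lincomb s (fun x => F x y)) z.
Proof.
elim: s => [|p s IH] H.
  by apply: eq_cdiff (cdiff_cst 0 z) => y; rewrite /lincomb big_nil.
apply: (@eq_cdiff _ (fun y => p.1%:C%C * F p.2 y + lincomb s (fun x => F x y))).
  by move=> y; rewrite /lincomb big_cons.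
apply: cdiffD; last by apply: IH => q qs; apply: H; rewrite in_cons qs orbT.
by apply: cdiffM; [exact: cdiff_cst|apply: H; rewrite mem_head].
Qed.

Lemma newton_coef_node k p : p \in newton_coef R k -> `|p.2| <= 5^-1.
Proof.
move=> pk; have /allP/(_ _ pk)/= /andP[p0 p5] := @small_newton R k.
by rewrite ger0_norm.
Qed.

Lemma slice_sepdiff m k phi : sepdiff m.+1 phi -> sepdiff m (slice k phi).
Proof.
move=> sd s1 s2 z sz a1 a2 zs.
apply: (@cdiff_lincomb (newton_coef R k) (fun x y => phi (x%:C%C :: s1 ++ y :: s2))).
move=> p /newton_coef_node p5; apply: (sd (p.2%:C%C :: s1) s2) => //.
  by rewrite -sz.
by rewrite /= in_sq_real.
Qed.

Lemma slice_bounded m k phi (M : R) : sepdiff m.+1 phi -> bounded_sq m.+1 phi M ->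
  bounded_sq m (slice k phi) (5 * M).
Proof.
move=> sd bd s sz sa.
apply: (@newton_coef_le R (fun y => phi (y :: s)) M k) => z zs.
  by apply: (sd [::] s) => //; rewrite sz.
by apply: bd; rewrite /= ?sz// zs.
Qed.

Lemma mlincomb_le m phi (M : R) al : sepdiff m phi -> bounded_sq m phi M ->
  size al = m -> cabs (mlincomb al (phi \o creals)) <= 5 ^+ m * M.
Proof.
elim: m phi M al => [|m IH] phi M [//|k al] sd bd //=.
  by rewrite /mlincomb big_seq1 mul1r expr0 mul1r bd.
move=> [sal]; rewrite mlincomb_cons exprSr -mulrA; apply: IH => //.
  exact: slice_sepdiff.
exact: slice_bounded.
Qed.

Lemma mmon_le m al w : size al = m -> size w = m -> all (fun x => `|x| <= 5^-1) w ->
  `|mmon al w| <= 1.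
Proof.
elim: m al w => [|m IH] [|k al] [|x w] //=; rewrite ?normr1//.
move=> [sal] [sw] /andP[x5 w5]; rewrite normrM -[leRHS]mulr1.
apply: ler_pM => //; last exact: IH.
by rewrite (le_trans (newton_mon_le _ x5))// exprn_ile1//; lra.
Qed.

Lemma sum_half_le N : \sum_(k < N) 2^-1 ^+ k <= 2 :> R.
Proof.
suff -> : \sum_(k < N) 2^-1 ^+ k = 2 - 2 * 2^-1 ^+ N :> R.
  by rewrite gerBl mulr_ge0 ?exprn_ge0// invr_ge0.
elim: N => [|N IH]; first by rewrite big_ord0 expr0; ring.
by rewrite big_ord_recr/= IH exprS; field.
Qed.

(** Expanding the first variable costs 5 M / 2^N. The slices are bounded by 5 M, and their own
    errors are weighted by monomials whose sum is at most 2. The constants thus obey C(m + 1) = 5 +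
    10 C(m), which 10^m - 1 dominates. *)
Theorem multivariate_newton m phi (M : R) w N : sepdiff m phi -> bounded_sq m phi M ->
  0 <= M -> size w = m -> all (fun x => `|x| <= 5^-1) w ->
  cabs (phi (creals w) -
    \sum_(al <- words N m) (mmon al w)%:C%C * mlincomb al (phi \o creals))
  <= (10 ^+ m - 1) * M / 2 ^+ N.
Proof.
elim: m phi M w => [|m IH] phi M [//|x w] sd bd M0 //=.
  move=> _ _; rewrite big_seq1 mul1r /mlincomb big_seq1 mul1r subrr cabs0.
  by rewrite expr0 subrr !mul0r.
move=> [sw] /andP[x5 w5].
rewrite big_allpairs_dep -{1}(subn0 N) -/(index_iota 0 N) big_mkord.
set f := fun y => phi (y :: creals w).
have win : all (@in_sq R) (creals w).
  by rewrite all_map; apply: sub_all w5 => y; exact: in_sq_real.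
have H1 := @newton_rem_le R f M N x x5.
have {}H1 : cabs (f x%:C%C - \sum_(k < N) (newton_mon k x)%:C%C *
    lincomb (newton_coef R k) (fun x => f x%:C%C)) <= 5 * M / 2 ^+ N.
  apply: H1 => z zs; first by apply: (sd [::] (creals w)) => //; rewrite size_map sw.
  by apply: bd; rewrite /= ?size_map ?sw// zs.
have H2 k : cabs (slice k phi (creals w) - \sum_(al <- words N m)
    (mmon al w)%:C%C * mlincomb al (slice k phi \o creals)) <=
    (10 ^+ m - 1) * (5 * M) / 2 ^+ N.
  apply: IH => //; [exact: slice_sepdiff|exact: slice_bounded|].
  by rewrite mulr_ge0.
(* The exact slices at the remaining coordinates are inserted between the one-variable expansion and
   the full one. *)
have -> : phi (x%:C%C :: creals w) - \sum_(k < N) \sum_(al <- words N m)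
    (newton_mon k x * mmon al w)%:C%C * mlincomb (nat_of_ord k :: al) (phi \o creals) =
  (f x%:C%C - \sum_(k < N) (newton_mon k x)%:C%C * slice k phi (creals w)) +
  \sum_(k < N) (newton_mon k x)%:C%C * (slice k phi (creals w) -
     \sum_(al <- words N m) (mmon al w)%:C%C * mlincomb al (slice k phi \o creals)).
  under [X in _ = _ + X]eq_bigr do rewrite mulrBr.
  rewrite sumrB addrA subrK; congr (_ - _); apply: eq_bigr => k _.
  rewrite mulr_sumr; apply: eq_bigr => al _.
  by rewrite rmorphM/= mlincomb_cons mulrA.
rewrite (le_trans (cabsD _ _))//; apply: (le_trans (lerD H1 _)).
  have csum (I : Type) (r : seq I) (F : I -> R[i]) :
      cabs (\sum_(i <- r) F i) <= \sum_(i <- r) cabs (F i).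
    elim: r => [|i r IHr]; first by rewrite !big_nil cabs0.
    by rewrite !big_cons (le_trans (cabsD _ _))// lerD2l.
  apply: (le_trans (csum _ _ _)).
  apply: (@le_trans _ _ (\sum_(k < N) 2^-1 ^+ k * ((10 ^+ m - 1) * (5 * M) / 2 ^+ N))).
    apply: ler_sum => k _; rewrite cabsM cabs_real; apply: ler_pM => //.
      exact: cabs_ge0.
    exact: newton_mon_le.
  rewrite -mulr_suml; apply: (@ler_wpM2r _ _ _ _ 2) (sum_half_le N).
  have m1 : 1 <= 10 ^+ m :> R by apply: exprn_ege1; lra.
  by rewrite !mulr_ge0 ?subr_ge0// invr_ge0 exprn_ge0.
rewrite !mulrA -!mulrDl ler_wpM2r ?invr_ge0 ?exprn_ge0// -[_ * 5]mulrC.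
rewrite exprS; have := exprn_ge0 m (ler0n R 10) => h; nra.
Qed.

End MultivariateNewton.

(** * Essentially bounded functions and their averages *)

Section EssentialBounds.
Variables (R : realType) (a b : R).
Notation leb := (@lebesgue_measure R).
Notation mab := (lebI a b).
Implicit Types (f g : R -> R) (F : R -> R[i]) (c : R) (E : set R).

#[global] Instance lebI_ae_filter : Filter (nbhs (almost_everywhere (lebI a b))).
Proof.
exact: (ae_filter_ringOfSetsType (mrestr leb (@measurable_itv R `[a, b]))).
Qed.

#[global] Instance lebesgue_ae_filter : Filter (nbhs (almost_everywhere leb)).
Proof. exact: ae_filter_ringOfSetsType. Qed.

Lemma linf_leP f c : (linf a b f <= c%:E)%E <-> \forall t \ae mab, `|f t| <= c.
Proof.
split=> [/ess_supP H|H]; first by apply: filterS H => t; rewrite lee_fin.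
by apply/ess_supP; apply: filterS H => t; rewrite lee_fin.
Qed.

Lemma linfC_leP F c : (linfC a b F <= c%:E)%E <-> \forall t \ae mab, cabs (F t) <= c.
Proof.
split=> [/ess_supP H|H]; first by apply: filterS H => t; rewrite lee_fin.
by apply/ess_supP; apply: filterS H => t; rewrite lee_fin.
Qed.

Lemma ae_lebI (P : set R) : (\forall t \ae mab, P t) ->
  {ae leb, forall t, `[a, b]%classic t -> P t}.
Proof.
move=> [N [mN N0 PN]]; exists (N `&` `[a, b]%classic); split.
- by apply: measurableI => //; exact: measurable_itv.
- exact: N0.
- by move=> t /= /not_implyP[tab nP]; split=> //; apply: PN.
Qed.

(** The essential supremum may be -oo, as on a null interval; the bound 0 covers that case. *)
Lemma linf_bound f : (linf a b f < +oo)%E -> exists2 c, 0 <= c & (linf a b f <= c%:E)%E.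
Proof.
case E : (linf a b f) => [r| |] // _.
  by exists `|r| => //; rewrite lee_fin ler_norm.
by exists 0 => //; rewrite leNye.
Qed.

Lemma linfC_bound F : (linfC a b F < +oo)%E ->
  exists2 c, 0 <= c & (linfC a b F <= c%:E)%E.
Proof.
case E : (linfC a b F) => [r| |] // _.
  by exists `|r| => //; rewrite lee_fin ler_norm.
by exists 0 => //; rewrite leNye.
Qed.

Lemma linf_triangle f g c d : (linf a b f <= c%:E)%E -> (linf a b g <= d%:E)%E ->
  (linf a b (fun t => f t + g t)%R <= (c + d)%:E)%E.
Proof.
move=> /linf_leP fc /linf_leP gd; apply/linf_leP.
by apply: filterS2 fc gd => t ? ?; rewrite (le_trans (ler_normD _ _))// lerD.
Qed.

Lemma linf_scale f (k c : R) : (linf a b f <= c%:E)%E ->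
  (linf a b (fun t => k * f t)%R <= (`|k| * c)%:E)%E.
Proof.
move=> /linf_leP fc; apply/linf_leP; apply: filterS fc => t ?.
by rewrite normrM ler_wpM2l.
Qed.

Lemma eq_linf f g : (\forall t \ae mab, f t = g t) -> linf a b f = linf a b g.
Proof. by move=> fg; apply: eq_ess_sup; apply: filterS fg => t ->. Qed.

Lemma linf0 c : 0 <= c -> (linf a b (fun=> 0%R) <= c%:E)%E.
Proof. by move=> c0; apply/linf_leP; apply: nearW => t; rewrite normr0. Qed.

Lemma linf_sum (I : Type) (r : seq I) (k : I -> R) (B : I -> R -> R) (d : I -> R) (M : R) :
  0 <= M ->
  (forall i, (linf a b (B i) <= M%:E)%E) -> (forall i, `|k i| <= d i) ->
  (linf a b (fun t => \sum_(i <- r) k i * B i t)%R <= (\sum_(i <- r) d i * M)%:E)%E.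
Proof.
move=> M0 BM kd; elim: r => [|i r IH].
  by under eq_fun do rewrite big_nil; rewrite big_nil; exact: linf0.
under eq_fun do rewrite big_cons.
rewrite big_cons; apply: linf_triangle IH.
by rewrite (le_trans (linf_scale _ (BM i)))// lee_fin ler_wpM2r.
Qed.

Lemma Linf_sum (I : eqType) (r : seq I) (k : I -> R) (B : I -> R -> R) :
  (forall i, i \in r -> Linf a b (B i)) ->
  Linf a b (fun t => \sum_(i <- r) k i * B i t).
Proof.
elim: r => [_|i r IH HB].
  under eq_fun do rewrite big_nil; split; first exact: measurable_cst.
  by rewrite (le_lt_trans (linf0 (lexx 0)))// ltry.
under eq_fun do rewrite big_cons.
have [m2 /linf_bound[c2 c20 H2]] := HB i (mem_head i r).
have [|m1 /linf_bound[c1 c10 H1]] := IH.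
  by move=> j jr; apply: HB; rewrite in_cons jr orbT.
split.
  by apply: measurable_funD => //; apply: measurable_funM => //; exact: measurable_cst.
by rewrite (le_lt_trans (linf_triangle (linf_scale (k i) H2) H1))// ltry.
Qed.

Lemma LinfC_Re F : LinfC a b F -> Linf a b (fun t => complex.Re (F t)).
Proof.
move=> [mR [_ /linfC_bound[c _ /linfC_leP H]]]; split=> //.
apply: (@le_lt_trans _ _ c%:E); last by rewrite ltry.
by apply/linf_leP; apply: filterS H => t; apply: le_trans; exact: Re_le_cabs.
Qed.

Lemma LinfC_Im F : LinfC a b F -> Linf a b (fun t => complex.Im (F t)).
Proof.
move=> [_ [mI /linfC_bound[c _ /linfC_leP H]]]; split=> //.
apply: (@le_lt_trans _ _ c%:E); last by rewrite ltry.
by apply/linf_leP; apply: filterS H => t; apply: le_trans; exact: Im_le_cabs.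
Qed.

Lemma LinfC_ReIm F : Linf a b (fun t => complex.Re (F t)) ->
  Linf a b (fun t => complex.Im (F t)) -> LinfC a b F.
Proof.
move=> [mR /linf_bound[c _ /linf_leP cR]] [mI /linf_bound[d _ /linf_leP dI]].
split=> //; split=> //; apply: (@le_lt_trans _ _ (c + d)%:E); last by rewrite ltry.
apply/linfC_leP; apply: filterS2 cR dI => t ? ?.
by rewrite (le_trans (cabs_le_ReIm _))// lerD.
Qed.

Lemma LinfD f g : Linf a b f -> Linf a b g -> Linf a b (fun t => f t + g t).
Proof.
move=> [mf /linf_bound[c _ Hc]] [mg /linf_bound[d _ Hd]]; split.
  exact: measurable_funD.
by rewrite (le_lt_trans (linf_triangle Hc Hd))// ltry.
Qed.

Lemma LinfZ (k : R) f : Linf a b f -> Linf a b (fun t => k * f t).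
Proof.
move=> [mf /linf_bound[c _ Hc]]; split.
  by apply: measurable_funM => //; exact: measurable_cst.
by rewrite (le_lt_trans (linf_scale k Hc))// ltry.
Qed.

Lemma LinfCD F G : LinfC a b F -> LinfC a b G -> LinfC a b (fun t => F t + G t).
Proof.
move=> HF HG; apply: LinfC_ReIm; under eq_fun do rewrite ReImE.
  by apply: LinfD; exact: LinfC_Re.
by apply: LinfD; exact: LinfC_Im.
Qed.

Lemma LinfCZ (k : R[i]) F : LinfC a b F -> LinfC a b (fun t => k * F t).
Proof.
move=> HF; apply: LinfC_ReIm; under eq_fun do rewrite ReImE.
  under eq_fun do rewrite -mulNr.
  by apply: LinfD; apply: LinfZ; [exact: LinfC_Re|exact: LinfC_Im].
by apply: LinfD; apply: LinfZ; [exact: LinfC_Im|exact: LinfC_Re].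
Qed.

(** * Integrals over measurable subsets of the interval *)

Definition subitv E := measurable E /\ E `<=` `[a, b]%classic.

Definition mass E : R := fine (leb E).

Lemma subitv_fin E : subitv E -> (leb E < +oo)%E.
Proof.
move=> [mE Eab]; apply: (@le_lt_trans _ _ (leb `[a, b]%classic)).
  by apply: le_measure => //; rewrite inE//=; exact: measurable_itv.
by rewrite lebesgue_measure_itv/=; case: ifP => _; rewrite ltry.
Qed.

Lemma mass_ge0 E : 0 <= mass E.
Proof. exact: fine_ge0. Qed.

Lemma massE E : subitv E -> (mass E)%:E = leb E.
Proof. by move=> sE; rewrite fineK// ge0_fin_numE// subitv_fin. Qed.

Lemma Linf_integral_abs f c E : subitv E -> measurable_fun `[a, b] f -> 0 <= c ->
  (linf a b f <= c%:E)%E -> (\int[leb]_(t in E) `|(f t)%:E| <= (c * mass E)%:E)%E.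
Proof.
move=> sE mf c0 /linf_leP/ae_lebI H; have [mE Eab] := sE.
have mfE : measurable_fun E f by apply: measurable_funS mf => //; exact: measurable_itv.
rewrite EFinM massE// -integral_cst//.
apply: ae_ge0_le_integral => //.
- by apply: measurableT_comp => //; exact/measurable_EFinP.
- by apply: filterS H => t Ht /Eab /Ht; rewrite /= lee_fin.
Qed.

Lemma Linf_integrable f E : subitv E -> Linf a b f -> leb.-integrable E (EFin \o f).
Proof.
move=> sE [mf /linf_bound[c c0 H]]; have [mE Eab] := sE; apply/integrableP; split.
  by apply/measurable_EFinP; apply: measurable_funS mf => //; exact: measurable_itv.
by rewrite (le_lt_trans (Linf_integral_abs sE mf c0 H))// ltry.
Qed.

Lemma Linf_integral_le f c E : subitv E -> Linf a b f -> 0 <= c ->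
  (linf a b f <= c%:E)%E -> `|\int[leb]_(t in E) f t| <= c * mass E.
Proof.
move=> sE Hf c0 H; have [mE Eab] := sE.
rewrite -lee_fin EFin_normr_Rintegral//; last exact: Linf_integrable.
apply: le_trans (Linf_integral_abs sE Hf.1 c0 H).
by apply: le_abse_integral => //; have /integrableP[] := Linf_integrable sE Hf.
Qed.

(** On the set E where f > 2 c the integral is at least 2 c times the measure of E and at most c
    times it, so E is null. The slack between c and 2 c settles this in one inequality; the same
    argument for -f gives the other side. *)
Lemma linf_from_averages f c : measurable_fun `[a, b] f -> Linf a b f -> 0 < c ->
  (forall E, subitv E -> `|\int[leb]_(t in E) f t| <= c * mass E) ->
  (linf a b f <= (2 * c)%:E)%E.
Proof.
move=> mf Lf c0 H; have mI := @measurable_itv R `[a, b].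
have null g : measurable_fun `[a, b] g -> Linf a b g ->
    (forall E, subitv E -> \int[leb]_(t in E) g t <= c * mass E) ->
    leb (`[a, b]%classic `&` [set t | 2 * c < g t]) = 0%E.
  move=> mg Lg Hg; set E := _ `&` _.
  have mE : measurable E.
    rewrite /E (_ : [set t | _] = g @^-1` `]2 * c, +oo[%classic); last first.
      by apply/seteqP; split => t /=; rewrite in_itv/= andbT.
    exact: mg.
  have sE : subitv E by split=> //; exact: subIsetl.
  have : 2 * c * mass E <= \int[leb]_(t in E) g t.
    rewrite /mass -Rintegral_cst//; apply: le_Rintegral => //.
    - apply: (@Linf_integrable (fun=> 2 * c) _ sE); split; first exact: measurable_cst.
      apply: (@le_lt_trans _ _ `|2 * c|%:E); last by rewrite ltry.
      by apply/linf_leP; exact: nearW.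
    - exact: Linf_integrable.
    - by move=> t [_ /= /ltW].
  move=> h1; have h2 := Hg E sE; have m0 := mass_ge0 E.
  have : 2 * c * mass E - c * mass E <= 0 by rewrite subr_le0 (le_trans h1 h2).
  have -> : 2 * c * mass E - c * mass E = c * mass E by ring.
  rewrite pmulr_rle0// => m0'.
  by rewrite -massE//; congr EFin; apply/eqP; rewrite eq_le m0 m0'.
apply/linf_leP.
have N1 := null f mf Lf (fun E sE => le_trans (ler_norm _) (H E sE)).
have Lnf : Linf a b (fun t => -1 * f t) by exact: LinfZ.
have N2 : leb (`[a, b]%classic `&` [set t | 2 * c < -1 * f t]) = 0%E.
  apply: null => //; first exact: Lnf.1.
  move=> E sE; rewrite RintegralZl ?mulN1r; [|exact: sE.1|exact: Linf_integrable].
  by rewrite (le_trans _ (H E sE))// -normrN ler_norm.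
have mE1 : measurable (`[a, b]%classic `&` [set t | 2 * c < f t]).
  rewrite (_ : [set t | _] = f @^-1` `]2 * c, +oo[%classic); last first.
    by apply/seteqP; split => t /=; rewrite in_itv/= andbT.
  exact: mf.
have mE2 : measurable (`[a, b]%classic `&` [set t | 2 * c < -1 * f t]).
  rewrite (_ : [set t | _] = (fun t => -1 * f t) @^-1` `]2 * c, +oo[%classic); last first.
    by apply/seteqP; split => t /=; rewrite in_itv/= andbT.
  exact: Lnf.1.
set E1 := _ `&` _ in N1 mE1; set E2 := _ `&` _ in N2 mE2.
(* The complement of [a, b] has measure zero for the restricted measure, so it can join the
   exceptional set. *)
exists (~` `[a, b]%classic `|` (E1 `|` E2)); split.
- by apply: measurableU; [exact: measurableC|exact: measurableU].
- rewrite /lebI /mrestr setIUl setICl set0U.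
  apply/eqP; rewrite eq_le measure_ge0 andbT -[leRHS](adde0 0%E) -{1}N1 -N2.
  apply: (le_trans _ (measureU2 _ _ _)) => //.
  by apply: le_measure; rewrite ?inE//; [apply: measurableI => //; exact: measurableU|exact: measurableU].
- move=> t /= nt; have [tab|] := pselect (`[a, b]%classic t); last by left.
  right; move: nt => /negP; rewrite -ltNge lter_normr => /orP[h|h].
    by left.
  by right; split=> //=; rewrite mulN1r.
Qed.

Definition integralC E F : R[i] :=
  Complex (\int[leb]_(t in E) complex.Re (F t)) (\int[leb]_(t in E) complex.Im (F t)).

Lemma integralCD E F G : subitv E -> LinfC a b F -> LinfC a b G ->
  integralC E (fun t => F t + G t) = integralC E F + integralC E G.
Proof.
move=> sE HF HG; have mE := sE.1; apply: eq_ReIm; rewrite ReImE /=.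
  under eq_Rintegral do rewrite ReImE.
  by rewrite RintegralD//; apply: Linf_integrable => //; exact: LinfC_Re.
under eq_Rintegral do rewrite ReImE.
by rewrite RintegralD//; apply: Linf_integrable => //; exact: LinfC_Im.
Qed.

Lemma integralCZ E (k : R[i]) F : subitv E -> LinfC a b F ->
  integralC E (fun t => k * F t) = k * integralC E F.
Proof.
move=> sE HF; have mE := sE.1.
have iR := Linf_integrable sE (LinfC_Re HF); have iI := Linf_integrable sE (LinfC_Im HF).
have iZ (r : R) (g : R -> R) : Linf a b g -> leb.-integrable E (EFin \o (fun t => r * g t)).
  by move=> Hg; apply: Linf_integrable => //; exact: LinfZ.
apply: eq_ReIm; rewrite ReImE /=.
  under eq_Rintegral do rewrite ReImE.
  by rewrite RintegralB ?RintegralZl//; apply: iZ; [exact: LinfC_Re|exact: LinfC_Im].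
under eq_Rintegral do rewrite ReImE.
by rewrite RintegralD ?RintegralZl//; apply: iZ; [exact: LinfC_Im|exact: LinfC_Re].
Qed.

Lemma integralC_le E F c : subitv E -> LinfC a b F -> 0 <= c ->
  (linfC a b F <= c%:E)%E -> cabs (integralC E F) <= 2 * c * mass E.
Proof.
move=> sE HF c0 /linfC_leP H; rewrite (le_trans (cabs_le_ReIm _))//=.
rewrite -mulrA mulr2n mulrDl mul1r; apply: lerD; apply: Linf_integral_le => //.
- exact: LinfC_Re.
- by apply/linf_leP; apply: filterS H => t; apply: le_trans; exact: Re_le_cabs.
- exact: LinfC_Im.
- by apply/linf_leP; apply: filterS H => t; apply: le_trans; exact: Im_le_cabs.
Qed.

Lemma integral_sum (I : eqType) (r : seq I) (k : I -> R) (B : I -> R -> R) E :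
  subitv E -> (forall i, i \in r -> Linf a b (B i)) ->
  \int[leb]_(t in E) (\sum_(i <- r) k i * B i t) =
  \sum_(i <- r) k i * \int[leb]_(t in E) B i t.
Proof.
move=> sE; elim: r => [_|i r IH HB].
  under eq_Rintegral do rewrite big_nil.
  by rewrite big_nil Rintegral_cst ?mul0r//; exact: sE.1.
under eq_Rintegral do rewrite big_cons.
have Bi := HB i (mem_head i r).
have Br j : j \in r -> Linf a b (B j) by move=> jr; apply: HB; rewrite in_cons jr orbT.
rewrite big_cons RintegralD; [|exact: sE.1| |].
- by rewrite IH// RintegralZl; [|exact: sE.1|exact: Linf_integrable].
- by apply: Linf_integrable => //; exact: LinfZ.
- by apply: Linf_integrable => //; exact: Linf_sum.
Qed.

End EssentialBounds.

(** * Approximation on a polydisc and on W *)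

Section LocalApproximation.
Variables (R : realType) (a b : R) (m : nat) (U : set (cvec R m)).
Variable G : cvec R m -> R -> R[i].
Hypothesis openU : open U.
Hypothesis GL : forall z, U z -> LinfC a b (G z).
Hypothesis holoG : holomorphic_Linf a b U G.
Variables (c : 'rV[R]_m) (r M : R).
Hypothesis r0 : 0 < r.
Hypothesis M0 : 0 < M.

(** Maps a list of points of the unit square to the product of squares of half-side [r] around the
    real centre [c]; missing entries default to the centre. *)
Definition polydisc_pt (s : seq R[i]) : cvec R m :=
  (c + r *: \row_j complex.Re (nth 0 s j), r *: \row_j complex.Im (nth 0 s j)).

Hypothesis ptU : forall s, all (@in_sq R) s -> U (polydisc_pt s).
Hypothesis ptM : forall s, all (@in_sq R) s -> (linfC a b (G (polydisc_pt s)) <= M%:E)%E.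

Definition coord_vec (k : nat) (w : R[i]) : cvec R m :=
  (r *: \row_j (if (j : nat) == k then complex.Re w else 0),
   r *: \row_j (if (j : nat) == k then complex.Im w else 0)).

Lemma polydisc_pt_incr s1 s2 (y w : R[i]) :
  polydisc_pt (s1 ++ (y + w) :: s2) = polydisc_pt (s1 ++ y :: s2) + coord_vec (size s1) w.
Proof.
have H (p : R[i] -> R) (j : 'I_m) : (forall u v, p (u + v) = p u + p v) ->
    p (nth 0 (s1 ++ (y + w) :: s2) j) =
    p (nth 0 (s1 ++ y :: s2) j) + (if (j : nat) == size s1 then p w else 0).
  move=> pD; rewrite !nth_cat; case: ltngtP => // h; rewrite ?addr0//.
    by case E : (j - size s1)%N => [|n]//=; move: h; rewrite -subn_gt0 E.
  by rewrite h subnn /= pD.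
congr pair; apply/rowP => j; rewrite !mxE H ?mulrDr ?addrA//= => u v;
  by rewrite ReImE.
Qed.

Lemma coord_vec_norm k w : `|coord_vec k w| <= r * cabs w.
Proof.
have H (x : R) : `|x| <= cabs w ->
    `|(r *: \row_j (if (j : nat) == k then x else 0) : 'rV[R]_m)| <= r * cabs w.
  move=> xw; rewrite /Num.norm/= mx_normrE; apply: bigmax_le => [|[i j] _].
    by rewrite mulr_ge0 ?cabs_ge0// ltW.
  rewrite !mxE/= normrM (gtr0_norm r0) ler_wpM2l ?(ltW r0)//.
  by case: ifP => // _; rewrite normr0 cabs_ge0.
by rewrite prod_normE ge_max !H ?Re_le_cabs ?Im_le_cabs.
Qed.

Lemma coord_vec_sum (A : 'I_m -> R -> R[i]) (k : 'I_m) w t :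
  \sum_(j < m) ccoord (coord_vec k w) j * A j t = (r%:C%C * w) * A k t.
Proof.
rewrite (bigD1 k)//= big1 ?addr0 => [|j jk].
  by congr (_ * _); apply: eq_ReIm; rewrite ReImE /= !mxE eqxx; ring.
rewrite (_ : ccoord _ _ = 0) ?mul0r//; apply: eq_ReIm;
  by rewrite /= !mxE (negbTE (jk : (j : nat) != k)) mulr0.
Qed.

Variable E : set R.
Hypothesis sE : subitv a b E.

(** Integration over [E] does not see null sets, so this is a genuine scalar function of the point,
    to which the scalar theory applies. *)
Definition averaged (s : seq R[i]) := integralC E (G (polydisc_pt s)).

(** Integration over [E] is a bounded complex-linear functional, so it carries the L^oo derivative
    of [G] to a scalar one: in the k-th variable, r times the integral of [A k]. *)
Lemma averaged_sepdiff : sepdiff m averaged.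
Proof.
move=> s1 s2 z sz a1 a2 zs.
have km : (size s1 < m)%N by rewrite -sz ltnS leq_addr.
pose k := Ordinal km.
have Us y : in_sq y -> U (polydisc_pt (s1 ++ y :: s2)).
  by move=> ys; apply: ptU; rewrite all_cat/= a1 ys a2.
have [A [LA HA]] := holoG (Us z zs).
exists (integralC E (A k) * r%:C%C) => e e0.
have mE := mass_ge0 E; have r0' := ltW r0.
(* The error is magnified by 2 [mass E] in [integralC_le] and by [r] in [coord_vec_norm]; the added
   1 covers a null [E]. *)
have K0 : 0 < 1 + 2 * r * mass E by rewrite ltr_pwDl// !mulr_ge0.
have [d [d0 Hd]] := HA _ (divr_gt0 e0 K0).
set z0 := polydisc_pt (s1 ++ z :: s2) in HA Hd.
have Uz0 : U z0 by exact: Us.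
(* The displaced point must remain in [U] for its value to be integrable. *)
have [d1 d10 Hd1] : exists2 d1 : R, 0 < d1 & forall h : cvec R m, `|h| < d1 -> U (z0 + h).
  have /nbhs_normP[d1 /= d10 Hd1] : nbhs z0 U by exact: open_nbhs_nbhs.
  by exists d1 => // h hd; apply: Hd1; rewrite /= opprD addNKr normrN.
have [d' [d'0 Hd']] : exists d' : R, 0 < d' /\ forall w, cabs w < d' ->
    `|coord_vec k w| < Num.min d d1.
  exists (Num.min d d1 / r); split; first by rewrite divr_gt0// lt_min d0.
  move=> w; rewrite ltr_pdivlMr// mulrC; apply: le_lt_trans.
  exact: coord_vec_norm.
exists d'; split=> // w /Hd'; rewrite lt_min => /andP[wd wd1].
have w0 := cabs_ge0 w.
have L0 : LinfC a b (G z0) by exact: GL.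
have L1 : LinfC a b (G (z0 + coord_vec k w)) by apply/GL/Hd1.
set B := e / (1 + 2 * r * mass E) * (r * cabs w).
have K0' : 0 <= e / (1 + 2 * r * mass E) by rewrite divr_ge0 ?(ltW e0) ?(ltW K0).
have B0 : 0 <= B by rewrite mulr_ge0// mulr_ge0.
have bnd : (linfC a b (fun t => G (z0 + coord_vec k w) t + -1 * G z0 t +
    - (r%:C%C * w) * A k t)%R <= B%:E)%E.
  apply: le_trans (le_trans (Hd _ wd) _).
    rewrite le_eqVlt; apply/orP; left; apply/eqP; congr linfC; apply/funext => t.
    by rewrite coord_vec_sum mulN1r mulNr.
  by rewrite lee_fin ler_wpM2l ?coord_vec_norm.
have L2 : LinfC a b (fun t => -1 * G z0 t) by exact: LinfCZ.
have L3 : LinfC a b (fun t => - (r%:C%C * w) * A k t) by exact: LinfCZ.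
have L4 : LinfC a b (fun t => G (z0 + coord_vec k w) t + -1 * G z0 t) by exact: LinfCD.
have := integralC_le sE (LinfCD L4 L3) B0 bnd.
rewrite (integralCD sE L4 L3) (integralCD sE L1 L2) (integralCZ _ sE L0).
rewrite (integralCZ _ sE (LA k)) /averaged polydisc_pt_incr -/z0.
have -> : integralC E (G (z0 + coord_vec k w)) + -1 * integralC E (G z0) +
  - (r%:C%C * w) * integralC E (A k) = integralC E (G (z0 + coord_vec k w)) -
  integralC E (G z0) - integralC E (A k) * r%:C%C * w by ring.
move=> H; apply: (le_trans H).
rewrite /B (_ : 2 * _ * _ = e * cabs w * (2 * r * mass E / (1 + 2 * r * mass E))); last first.
  by field; rewrite gt_eqF.
rewrite -[leRHS]mulr1 ler_wpM2l ?mulr_ge0 ?(ltW e0)// ler_pdivrMr// mul1r.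
by rewrite lerDr.
Qed.

Lemma averaged_bounded : bounded_sq m averaged (2 * M * mass E).
Proof.
move=> s _ sa; apply: (integralC_le sE); [exact/GL/ptU|exact: ltW|exact: ptM].
Qed.

Lemma Re_real_mul (x : R) (z : R[i]) : complex.Re (x%:C%C * z) = x * complex.Re z.
Proof. by rewrite ReImE /= mul0r subr0. Qed.

Lemma Re_sum (I : Type) (s : seq I) (F : I -> R[i]) :
  complex.Re (\sum_(i <- s) F i) = \sum_(i <- s) complex.Re (F i).
Proof. by elim: s => [|i s IH]; rewrite ?big_nil// !big_cons ReImE IH. Qed.

Lemma mcoef_small al (p : R * seq R) : p \in mcoef R al ->
  all (fun x => `|x| <= 5^-1) p.2.
Proof.
elim: al p => [|k al IH] p; first by rewrite inE => /eqP ->.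
move=> /allpairsPdep[q [q' [qk q'al ->]]] /=.
by rewrite (newton_coef_node qk) IH.
Qed.

Lemma creals_in_sq (w : seq R) : all (fun x => `|x| <= 5^-1) w ->
  all (@in_sq R) (creals w).
Proof. by rewrite all_map; apply: sub_all => y; exact: in_sq_real. Qed.

Definition re_value (w : seq R) (t : R) : R := complex.Re (G (polydisc_pt (creals w)) t).

(** The tensor Newton functional applied to the real part of [G]. Its coefficients are real, so it
    commutes with taking real parts and scalar estimates for [averaged] apply to it. *)
Definition basis_fun (al : seq nat) (t : R) : R :=
  \sum_(p <- mcoef R al) p.1 * re_value p.2 t.

Lemma re_value_Linf w : all (fun x => `|x| <= 5^-1) w -> Linf a b (re_value w).
Proof. by move=> w5; apply/LinfC_Re/GL/ptU/creals_in_sq. Qed.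

Lemma basis_fun_Linf al : Linf a b (basis_fun al).
Proof.
apply: (@Linf_sum R a b _ (mcoef R al) (fun p => p.1) (fun p => re_value p.2)).
by move=> p /mcoef_small; exact: re_value_Linf.
Qed.

Lemma integral_basis_fun al : \int[lebesgue_measure]_(t in E) basis_fun al t =
  complex.Re (mlincomb al (averaged \o @creals R)).
Proof.
rewrite (@integral_sum R a b _ (mcoef R al) (fun p => p.1) (fun p => re_value p.2))//.
  by rewrite Re_sum; apply: eq_bigr => p _; rewrite Re_real_mul.
by move=> p /mcoef_small; exact: re_value_Linf.
Qed.

Lemma integral_basis_fun_le al : size al = m ->
  `|\int[lebesgue_measure]_(t in E) basis_fun al t| <= (5 ^+ m * (2 * M)) * mass E.
Proof.
move=> sal; rewrite integral_basis_fun (le_trans (Re_le_cabs _))//.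
by rewrite (le_trans (mlincomb_le averaged_sepdiff averaged_bounded sal))// !mulrA.
Qed.

Lemma integral_rem_le w N : size w = m -> all (fun x => `|x| <= 5^-1) w ->
  `|\int[lebesgue_measure]_(t in E)
     (re_value w t - \sum_(al <- words N m) mmon al w * basis_fun al t)| <=
  (10 ^+ m * (2 * M) / 2 ^+ N) * mass E.
Proof.
move=> sw w5.
have Lw := re_value_Linf w5.
have Ls : Linf a b (fun t => \sum_(al <- words N m) mmon al w * basis_fun al t).
  by apply: Linf_sum => al _; exact: basis_fun_Linf.
rewrite RintegralB; [|exact: sE.1|exact: (Linf_integrable sE Lw)|exact: (Linf_integrable sE Ls)].
rewrite (integral_sum _ sE); last by move=> al _; exact: basis_fun_Linf.
have M1 : 0 <= 2 * M * mass E by rewrite mulr_ge0 ?mass_ge0// mulr_ge0// ltW.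
have := multivariate_newton N averaged_sepdiff averaged_bounded M1 sw w5.
move=> H; have := le_trans (Re_le_cabs _) H.
rewrite ReImE Re_opp Re_sum.
under eq_bigr do rewrite Re_real_mul -integral_basis_fun.
move/le_trans; apply.
rewrite -subr_ge0 (_ : _ - _ = 2 * M * mass E / 2 ^+ N); last by field; rewrite expf_neq0.
by rewrite divr_ge0// exprn_ge0.
Qed.

End LocalApproximation.

(** * Patching finitely many polydiscs over the closure of [W] *)

Section UniformApproximation.
Variables (R : realType) (a b : R) (m : nat) (W : set 'rV[R]_m) (U : set (cvec R m)).
Variables (g : 'rV[R]_m -> R -> R) (G : cvec R m -> R -> R[i]).
Hypothesis boundedW : bounded_set W.
Hypothesis openU : open U.
Hypothesis WU : forall x, closure W x -> U (creal x).
Hypothesis GL : forall z, U z -> LinfC a b (G z).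
Hypothesis Gg : forall w, W w -> linfC a b (fun t => G (creal w) t - (g w t)%:C%C) = 0%E.
Hypothesis holoG : holomorphic_Linf a b U G.
Hypothesis bddG : bounded_on_compacts a b U G.

Lemma closed_ball_compact (c : 'rV[R]_m) (r : R) : 0 < r -> compact (closed_ball c r).
Proof.
move=> r0; apply: bounded_closed_compact; last exact: closed_ball_closed.
rewrite closed_ballE//; exists (`|c| + r); split; first exact: num_real.
move=> x xr y; rewrite /closed_ball_/= => cy; rewrite (le_trans _ (ltW xr))//.
rewrite (_ : y = c - (c - y)); last by rewrite opprB addrC subrK.
by rewrite (le_trans (ler_normB _ _))// lerD2l.
Qed.

Definition good_radius (c : 'rV[R]_m) (rM : R * R) :=
  [/\ 0 < rM.1, 0 < rM.2,
    forall s, all (@in_sq R) s -> U (polydisc_pt c rM.1 s) &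
    forall s, all (@in_sq R) s -> (linfC a b (G (polydisc_pt c rM.1 s)) <= rM.2%:E)%E].

(** The norms are max norms, so every [polydisc_pt] lies in a product of two closed balls. This
    product is compact and, for half of a radius admissible in [U], contained in [U]. *)
Lemma good_radius_exists c : closure W c -> exists rM, good_radius c rM.
Proof.
move=> /WU Uc.
have /nbhs_normP[d /= d0 Hd] : nbhs (creal c) U by exact: open_nbhs_nbhs.
pose r := d / 2; have r0 : 0 < r by rewrite divr_gt0.
have rd : r < d by rewrite ltr_pdivrMr// ltr_pMr// ltr1n.
pose K := closed_ball c r `*` closed_ball (0 : 'rV[R]_m) r.
have KU : K `<=` U.
  move=> [x y] [/=]; rewrite !closed_ballE// /closed_ball_ /= => cx cy.
  apply: Hd => /=; apply: le_lt_trans rd.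
  by rewrite /creal prod_normE ge_max /= cx.
have [M0 HM] := bddG KU (compact_setX (@closed_ball_compact c r r0) (@closed_ball_compact (0 : 'rV[R]_m) r r0)).
have inK s : all (@in_sq R) s -> K (polydisc_pt c r s).
  move=> sa.
  have H (p : R[i] -> R) : p 0 = 0 -> (forall z, in_sq z -> `|p z| <= 1) ->
      `|r *: \row_(j < m) p (nth 0 s j)| <= r.
    move=> p00 p1; rewrite /Num.norm/= mx_normrE; apply: bigmax_le => [|[i j] _].
      exact: ltW.
    rewrite !mxE/= normrM (gtr0_norm r0) -[leRHS]mulr1 ler_wpM2l ?(ltW r0)//.
    have [js|js] := ltnP j (size s); first by apply/p1/(allP sa)/mem_nth.
    by rewrite nth_default// p00 normr0.
  rewrite /K !closed_ballE// /closed_ball_ /polydisc_pt; split => /=.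
    rewrite opprD addNKr normrN; apply: H => // z /andP[z1 _].
    by rewrite ler_norml.
  rewrite sub0r normrN; apply: H => // z /andP[_ z1].
  by rewrite ler_norml.
exists (r, Num.max 1 M0); split => //=.
- by rewrite lt_max ltr01.
- by move=> s /inK /KU.
- by move=> s /inK /HM /le_trans; apply; rewrite lee_fin le_max lexx orbT.
Qed.

Definition offset (c w : 'rV[R]_m) (r : R) : seq R :=
  [seq (w 0 j - c 0 j) / r | j <- enum 'I_m].

Lemma polydisc_pt_offset c w (r : R) : 0 < r ->
  polydisc_pt c r (creals (offset c w r)) = creal w.
Proof.
move=> r0; have H (j : 'I_m) : nth 0 (creals (offset c w r)) j = ((w 0 j - c 0 j) / r)%:C%C.
  rewrite /creals /offset -map_comp (nth_map j) ?size_enum_ord//=.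
  by rewrite nth_ord_enum.
congr pair; apply/rowP => j; rewrite !mxE H /=; last by rewrite mulr0.
by rewrite mulrC divfK ?gt_eqF// addrC subrK.
Qed.

Lemma mx_entry_le (v : 'rV[R]_m) j : `|v 0 j| <= `|v|.
Proof.
rewrite [leRHS]/Num.norm/= mx_normrE.
exact: (@le_bigmax_cond _ _ _ _ (0, j) xpredT (fun ij => `|v ij.1 ij.2|)).
Qed.

Lemma offset_small c w (r : R) : 0 < r -> `|c - w| <= r / 5 ->
  all (fun x => `|x| <= 5^-1) (offset c w r).
Proof.
move=> r0 cw; rewrite all_map; apply/allP => j _ /=.
rewrite normrM [`|r^-1|]gtr0_norm ?invr_gt0// ler_pdivrMr// mulrC.
by rewrite (le_trans _ cw)// distrC (le_trans _ (mx_entry_le _ j))// !mxE.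
Qed.

Lemma size_offset c w (r : R) : size (offset c w r) = m.
Proof. by rewrite size_map size_enum_ord. Qed.

(** The local bases of a finite cover are concatenated; a given [w] uses only the block of one
    centre near it. The common bounds on the [B i] and on the coefficients are what rounding in the
    entropy estimate relies on. *)
Theorem uniform_approximation : exists (J : nat) (M : R), 0 < M /\
  forall N n, (J * N ^ m <= n)%N -> exists B : nat -> R -> R,
    (forall i, Linf a b (B i)) /\ (forall i, (linf a b (B i) <= M%:E)%E) /\
    forall w, W w -> exists k : nat -> R, (forall i, `|k i| <= 1) /\
      (linf a b (fun t => g w t - \sum_(i < n) k i * B i t)%R <= (M / 2 ^+ N)%:E)%E.
Proof.
have cptW : compact (closure W).
  apply: bounded_closed_compact; last exact: closed_closure.
  have [M [Mr HM]] := boundedW; pose e := `|M| + 1.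
  have e0 : 0 < e by rewrite ltr_wpDl.
  have Me : M < e by rewrite (le_lt_trans (ler_norm M))// ltrDl.
  exists e; split=> [|x ex y Wy]; first exact: num_real.
  have : closed_ball (0 : 'rV[R]_m) e y.
    have cl : closed (closed_ball (0 : 'rV[R]_m) e) by exact: closed_ball_closed.
    rewrite ((closure_id _).1 cl).
    apply: closure_subset Wy => z Wz; rewrite closed_ballE// /closed_ball_ /= sub0r normrN.
    exact: HM Me z Wz.
  rewrite closed_ballE// /closed_ball_ /= sub0r normrN => /le_trans; apply; exact: ltW.
have /choice[rM HrM] : forall c, exists rM, closure W c -> good_radius c rM.
  move=> c; have [cW|nW] := pselect (closure W c); last by exists (1, 1).
  by have [p Hp] := good_radius_exists cW; exists p.
(* Balls of a fifth of the radius, so that relative coordinates lie in [-1/5, 1/5], where the Newton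
   estimates hold. *)
have [D' D'W cov] : finite_subset_cover (closure W)
    (fun c => ball c ((rM c).1 / 5)) (closure W).
  move: cptW; rewrite compact_cover; apply.
    by move=> c cW; apply: ball_open; have [r0 _ _ _] := HrM c cW; rewrite divr_gt0.
  by move=> c cW; exists c => //; apply: ballxx; have [r0 _ _ _] := HrM c cW; rewrite divr_gt0.
pose ds : seq 'rV[R]_m := finmap.enum_fset D'.
have dsW c : c \in ds -> closure W c by move=> /D'W; rewrite inE.
have dsu : uniq ds by exact: finmap.fset_uniq.
pose Mmax := \sum_(c <- ds) (rM c).2.
have Mle c : c \in ds -> (rM c).2 <= Mmax.
  move=> cds; rewrite /Mmax (big_rem c)//= lerDl big_seq sumr_ge0// => c' /mem_rem c'ds.
  by have [_ /ltW] := HrM c' (dsW c' c'ds).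
have Mmax0 : 0 <= Mmax.
  rewrite /Mmax big_seq sumr_ge0// => c cds.
  by have [_ /ltW] := HrM c (dsW c cds).
(* The local remainder constant is 2 10^m times the local bound, and passing from averages to the
   norm doubles it. The same constant dominates the norms of the basis functions; the added 1
   ensures positivity if the cover is empty. *)
exists (size ds), (4 * 10 ^+ m * Mmax + 1); split.
  by rewrite ltr_wpDl// mulr_ge0// mulr_ge0// exprn_ge0.
move=> N n nN.
pose P := [seq (c, al) | c <- ds, al <- words N m].
have sP : size P = (size ds * N ^ m)%N by rewrite size_allpairs size_words.
pose p0 : 'rV[R]_m * seq nat := (0, [::]).
pose F (p : 'rV[R]_m * seq nat) := basis_fun G p.1 (rM p.1).1 p.2.
have PF i : (i < size P)%N -> (nth p0 P i).1 \in ds /\ (nth p0 P i).2 \in words N m.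
  by move=> /(mem_nth p0) /allpairsPdep[c [al [cds al_ ->]]].
(* Padding by zero functions meets any [n] above the number of basis functions. *)
exists (fun i => if (i < size P)%N then F (nth p0 P i) else fun=> 0).
have L0 : Linf a b (fun=> 0).
  split; first exact: measurable_cst.
  by rewrite (le_lt_trans (linf0 a b (lexx 0)))// ltry.
split.
  move=> i; case: ifP => // /PF[cds _].
  have [r0 M0 H1 H2] := HrM _ (dsW _ cds).
  exact: (basis_fun_Linf GL).
split.
  move=> i; case: ifP => [/PF[cds al_]|_]; last first.
    by apply: linf0; rewrite addr_ge0// mulr_ge0// mulr_ge0// exprn_ge0.
  have [r0 M0 H1 H2] := HrM _ (dsW _ cds).
  have LF : Linf a b (F (nth p0 P i)) by exact: (basis_fun_Linf GL).
  set c := (nth p0 P i).1 in cds r0 M0 H1 H2 *.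
  have C0 : 0 < 5 ^+ m * (2 * (rM c).2) by rewrite mulr_gt0 ?exprn_gt0// mulr_gt0.
  apply: (le_trans (linf_from_averages LF.1 LF C0 _)).
    move=> E sE.
    exact: (integral_basis_fun_le openU GL holoG r0 M0 H1 H2 sE (size_in_words al_)).
  rewrite lee_fin.
  have : 5 ^+ m * (rM c).2 <= 10 ^+ m * Mmax.
    apply: ler_pM; rewrite ?exprn_ge0 ?(ltW M0) ?Mle//.
    by rewrite lerXn2r ?nnegrE//; lra.
  lra.
move=> w Ww.
have [c /= cD cw] := cov w (subset_closure Ww).
have cds : c \in ds := cD.
have [r0 M0 H1 H2] := HrM _ (dsW _ cds).
set r := (rM c).1 in cw r0 H1 H2 *.
have cwr : `|c - w| <= r / 5 by move: cw; rewrite -ball_normE /= => /ltW.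
have w5 := offset_small r0 cwr; have sw := size_offset c w r.
pose kc (p : 'rV[R]_m * seq nat) := if p.1 == c then mmon p.2 (offset c w r) else 0.
exists (fun i => if (i < size P)%N then kc (nth p0 P i) else 0); split.
  move=> i; case: ifP => [/PF[_ al_]|_]; last by rewrite normr0.
  rewrite /kc; case: ifP => _; last by rewrite normr0.
  exact: (mmon_le (size_in_words al_) sw w5).
(* Terms beyond [size P] vanish, and among the others only the block of [c] survives, once since
   [ds] is duplicate-free. *)
have sumE t : \sum_(i < n) (if (i < size P)%N then kc (nth p0 P i) else 0) *
      (if (i < size P)%N then F (nth p0 P i) else fun=> 0) t =
    \sum_(al <- words N m) mmon al (offset c w r) * basis_fun G c r al t.
  rewrite -(big_mkord xpredT (fun i => (if (i < size P)%N then kc (nth p0 P i) else 0) *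
      (if (i < size P)%N then F (nth p0 P i) else fun=> 0) t)).
  rewrite (@big_cat_nat _ _ _ (size P))//= ?sP// -sP [X in _ + X]big_nat [X in _ + X]big1 ?addr0; last first.
    by move=> i /andP[+ _]; rewrite leqNgt => /negbTE ->; rewrite mul0r.
  rewrite big_nat (eq_bigr (fun i => kc (nth p0 P i) * F (nth p0 P i) t)); last first.
    by move=> i /andP[_ ->].
  rewrite -big_nat -(big_nth p0 xpredT (fun p => kc p * F p t)) big_allpairs_dep /=.
  rewrite (bigD1_seq c)//= [X in _ + X]big1 ?addr0; last first.
    by move=> c' /negbTE cc'; rewrite big1// => al _; rewrite /kc /= cc' mul0r.
  by apply: eq_bigr => al _; rewrite /kc /= eqxx.
have Lrem : Linf a b (fun t => re_value G c r (offset c w r) t -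
    \sum_(al <- words N m) mmon al (offset c w r) * basis_fun G c r al t).
  under eq_fun do rewrite -mulN1r.
  apply: LinfD; first exact: (re_value_Linf GL H1 w5).
  by apply: LinfZ; apply: Linf_sum => al _; exact: (basis_fun_Linf GL).
have C0 : 0 < 10 ^+ m * (2 * (rM c).2) / 2 ^+ N.
  by rewrite divr_gt0 ?exprn_gt0// mulr_gt0 ?exprn_gt0// mulr_gt0.
have main := linf_from_averages Lrem.1 Lrem C0 (fun E sE =>
  integral_rem_le openU GL holoG r0 M0 H1 H2 sE N sw w5).
(* Almost everywhere [g w] is the value of [G] at [creal w], hence equals its real part. *)
rewrite (@eq_linf _ _ _ _ (fun t => re_value G c r (offset c w r) t -
    \sum_(al <- words N m) mmon al (offset c w r) * basis_fun G c r al t)); last first.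
  have /linfC_leP : (linfC a b (fun t => G (creal w) t - (g w t)%:C%C)%R <= 0%:E)%E.
    by rewrite Gg.
  apply: filterS => t h; rewrite sumE; congr (_ - _).
  rewrite /re_value polydisc_pt_offset//.
  have /eqP : cabs (G (creal w) t - (g w t)%:C%C) = 0.
    by apply/eqP; rewrite eq_le h cabs_ge0.
  by rewrite cabs_eq0 subr_eq0 => /eqP ->.
apply: (le_trans main); rewrite lee_fin mulrA ler_wpM2r ?invr_ge0 ?exprn_ge0//.
have : 10 ^+ m * (rM c).2 <= 10 ^+ m * Mmax by rewrite ler_wpM2l ?exprn_ge0// Mle.
lra.
Qed.

End UniformApproximation.

(** * Widths and entropy numbers *)

Section Rates.
Variable R : realType.

(** Take the largest N within the budget. Then n < L (N + 1)^p <= (L (N + 1))^p, so n^(1/p) <= L (N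
    + 1); the factor 2 pays for replacing 2^-N by 2^-(N + 1). *)
Lemma budget_rate (L p n : nat) : (0 < L)%N -> (0 < p)%N ->
  exists N : nat, (L * N ^ p <= n)%N /\
    (2 ^+ N)^-1 <= 2 * expR (- (ln 2 / L%:R) * n%:R `^ p%:R^-1) :> R.
Proof.
move=> L0 p0.
have Np N : (N <= N ^ p)%N.
  by case: N => // N; rewrite -[X in (X <= _)%N]expn1 leq_pexp2l.
have bnd N : (L * N ^ p <= n)%N -> (N <= n)%N.
  by apply: leq_trans; rewrite (leq_trans (Np N))// leq_pmull.
have ex0 : exists N, (L * N ^ p <= n)%N by exists 0%N; rewrite exp0n// muln0.
have [N HN maxN] := ex_maxnP ex0 bnd.
exists N; split=> //.
have nlt : (n < L * N.+1 ^ p)%N.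
  by rewrite ltnNge; apply/negP => /maxN; rewrite ltnn.
have nle : n%:R <= (L * N.+1)%:R ^+ p :> R.
  rewrite -natrX ler_nat (leq_trans (ltnW nlt))// expnMn leq_mul2r.
  apply/orP; right; rewrite -[X in (X <= _)%N]expn1 leq_pexp2l//.
have root : n%:R `^ p%:R^-1 <= (L * N.+1)%:R :> R.
  have -> : (L * N.+1)%:R = ((L * N.+1)%:R ^+ p) `^ p%:R^-1 :> R.
    by rewrite -powR_mulrn// -powRrM mulfV ?powRr1// pnatr_eq0 -lt0n.
  by apply: ge0_ler_powR; rewrite ?nnegrE ?invr_ge0// exprn_ge0.
have ln2 : 0 < ln 2 :> R by apply: ln_gt0; rewrite ltr1n.
have -> : (2 ^+ N)^-1 = 2 * expR (- (ln 2 * N.+1%:R)) :> R.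
  rewrite expRN expRM_natr lnK ?posrE// exprS; field; by rewrite expf_neq0.
rewrite ler_pM2l// ler_expR mulNr lerN2 mulrAC ler_pdivrMr ?ltr0n//.
by rewrite -mulrA ler_pM2l// mulrC -natrM.
Qed.

End Rates.

(** * From approximation by a common basis to widths and nets *)

Section WidthsAndEntropy.
Variables (R : realType) (a b : R) (m : nat) (D : set (R -> R)) (J : nat) (M : R).
Hypothesis m0 : (0 < m)%N.
Hypothesis M0 : 0 < M.
Hypothesis approx : forall N n, (J * N ^ m <= n)%N -> exists B : nat -> R -> R,
  (forall i, Linf a b (B i)) /\ (forall i, (linf a b (B i) <= M%:E)%E) /\
  forall f, D f -> exists k : nat -> R, (forall i, `|k i| <= 1) /\
    (linf a b (fun t => f t - \sum_(i < n) k i * B i t)%R <= (M / 2 ^+ N)%:E)%E.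

Lemma kwidth_le N n : (J * N ^ m <= n)%N -> (kwidth a b D n <= (M / 2 ^+ N)%:E)%E.
Proof.
move=> /approx[B [BL [_ Bk]]]; apply: (le_trans (ereal_inf_lbound _)).
  by exists (fun i : 'I_n => B i); [move=> i; exact: BL|reflexivity].
apply: ge_ereal_sup => _ [f Df <-].
have [k [_ Hk]] := Bk f Df.
apply: le_trans Hk; apply: ereal_inf_lbound.
by exists (fun i : 'I_n => k i).
Qed.

Definition dyadic (p i : nat) : R := i%:R / 2 ^+ p - 1.

(** Rounding down reaches the index 2^(p + 1) at x = 1, one too many for p + 1 bits. *)
Lemma dyadic_approx p (x : R) : `|x| <= 1 ->
  exists i : 'I_(2 ^ (p + 2)), `|x - dyadic p i| <= (2 ^+ p)^-1.
Proof.
rewrite ler_norml => /andP[xl xr].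
have p2 : 0 < 2 ^+ p :> R by rewrite exprn_gt0.
have y0 : 0 <= (x + 1) * 2 ^+ p by rewrite mulr_ge0 ?(ltW p2)// -lerBlDr sub0r.
have /andP[t1 t2] := truncn_itv y0; set i := Num.truncn _ in t1 t2.
have ip : (i < 2 ^ (p + 2))%N.
  rewrite -(ltr_nat R) (le_lt_trans t1)// natrX exprD mulrC ltr_pM2l//.
  lra.
exists (Ordinal ip); rewrite /dyadic /= ler_norml.
have -> : x - (i%:R / 2 ^+ p - 1) = ((x + 1) * 2 ^+ p - i%:R) / 2 ^+ p.
  by field; rewrite gt_eqF.
apply/andP; split.
  by rewrite (@le_trans _ _ 0)// ?oppr_le0 ?invr_ge0 ?(ltW p2)// divr_ge0 ?(ltW p2)// subr_ge0.
rewrite -[leRHS]mul1r ler_wpM2r ?invr_ge0 ?(ltW p2)//.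
by rewrite lerBlDl natr1 ltW.
Qed.

(** Three errors add up, in units of 2^-N: 1 for replacing [f] by a finite combination, M for
    expanding its terms in the basis, and J M for rounding the coefficients. *)
Lemma entropy_num_le N n : ((m.+1 * N + 2) * (J * N ^ m) <= n)%N ->
  (entropy_num a b (B1 a b D) n <= ((1 + M + J%:R * M) / 2 ^+ N)%:E)%E.
Proof.
move=> bits; set d := (J * N ^ m)%N in bits.
have [B [BL [BM Bk]]] := approx (leqnn d).
(* Rounding errors accumulate over [d] coefficients; since N^m <= 2^(m N), this precision still
   leaves d / 2^p <= J / 2^N. *)
set p := (m.+1 * N)%N in bits.
pose T : finType := {ffun 'I_d -> 'I_(2 ^ (p + 2))}.
have cT : (#|T| <= 2 ^ n)%N by rewrite card_ffun !card_ord -expnM leq_exp2l.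
have T0 : T.
  by refine [ffun=> Ordinal (_ : 0 < _)%N]; rewrite expn_gt0.
pose centre (x : T) t := \sum_(i < d) dyadic p (x i) * B i t.
have N2 : 0 < 2 ^+ N :> R by rewrite exprn_gt0.
apply: ereal_inf_lbound; exists ((1 + M + J%:R * M) / 2 ^+ N) => //; split.
  by rewrite divr_gt0// ltr_wpDr ?mulr_ge0 ?(ltW M0)// ltr_wpDr// ltW.
(* The net may have fewer than 2^n centres; the default [T0] fills the remaining indices. *)
exists (fun i => centre (nth T0 (enum T) i)); split.
  by move=> i; apply: Linf_sum => j _; exact: BL.
move=> f [_ Hf].
have [k [c [h [c1 [hD fh]]]]] := Hf (2 ^+ N)^-1 (eq_rect _ is_true N2 _ (esym (invr_gt0 _))).
have /choice[kk Hkk] : forall j : 'I_k, exists q : nat -> R, (forall i, `|q i| <= 1) /\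
    (linf a b (fun t => h j t - \sum_(i < d) q i * B i t)%R <= (M / 2 ^+ N)%:E)%E.
  by move=> j; exact: Bk.
(* A combination of any length [k] collapses to [d] coefficients, still in [-1, 1] because the [c j]
   have total mass at most 1; hence one net serves all of them. *)
pose beta (i : nat) := \sum_(j < k) c j * kk j i.
have beta1 i : `|beta i| <= 1.
  apply: le_trans c1; apply: (le_trans (ler_norm_sum _ _ _)); apply: ler_sum => j _.
  by rewrite normrM ler_piMr// (Hkk j).1.
have /choice[x Hx] : forall i : 'I_d, exists q : 'I_(2 ^ (p + 2)),
    `|beta i - dyadic p q| <= (2 ^+ p)^-1.
  by move=> i; exact: dyadic_approx.
pose X : T := [ffun i => x i].
have idx : (index X (enum T) < 2 ^ n)%N.
  by rewrite (leq_trans _ cT)// cardE index_mem mem_enum.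
exists (Ordinal idx); rewrite /= nth_index ?mem_enum//.
have E1 := linf_sum (index_enum 'I_k) (B := fun j t => h j t - \sum_(i < d) kk j i * B i t)
  (k := c) (d := fun j => `|c j|) (divr_ge0 (ltW M0) (ltW N2)) (fun j => (Hkk j).2)
  (fun j => lexx _).
have E2 := linf_sum (index_enum 'I_d) (B := fun i => B i) (k := fun i : 'I_d => beta i - dyadic p (x i))
  (d := fun=> (2 ^+ p)^-1) (ltW M0) (fun i => BM i) Hx.
have E3 := linf_triangle (ltW fh) (linf_triangle E1 E2).
rewrite (@eq_linf _ _ _ _ (fun t => f t - \sum_(j < k) c j * h j t +
    (\sum_(j < k) c j * (h j t - \sum_(i < d) kk j i * B i t) +
     \sum_(i < d) (beta i - dyadic p (x i)) * B i t))); last first.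
  apply: nearW => t.
  have -> : \sum_(j < k) c j * (h j t - \sum_(i < d) kk j i * B i t) =
      \sum_(j < k) c j * h j t - \sum_(i < d) beta i * B i t.
    under eq_bigr do rewrite mulrBr.
    rewrite sumrB; congr (_ - _); under eq_bigr do rewrite mulr_sumr.
    rewrite exchange_big /=; apply: eq_bigr => i _; rewrite mulr_suml.
    by apply: eq_bigr => j _; rewrite mulrA.
  have -> : \sum_(i < d) (beta i - dyadic p (x i)) * B i t =
      \sum_(i < d) beta i * B i t - centre X t.
    rewrite -sumrB; apply: eq_bigr => i _.
    by rewrite mulrBl ffunE.
  by ring.
apply: (le_trans E3); rewrite lee_fin -!mulr_suml sumr_const card_ord.
rewrite [leRHS]mulrDl [X in _ <= X + _]mulrDl mul1r -[leRHS]addrA.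
rewrite lerD2l; apply: lerD.
  by rewrite -[leRHS]mul1r ler_wpM2r// divr_ge0 ?(ltW M0)// ltW.
have dp : d%:R / 2 ^+ p <= J%:R / 2 ^+ N :> R.
  rewrite ler_pdivrMr ?exprn_gt0// /p mulSn exprD mulrA divfK ?gt_eqF//.
  rewrite -natrX -natrM ler_nat /d leq_mul2l; apply/orP; right.
  by rewrite mulnC expnM leq_exp2r// ltnW// ltn_expl.
by rewrite -[_ *+ d]mulr_natl [J%:R * M / _]mulrAC ler_wpM2r ?(ltW M0).
Qed.

End WidthsAndEntropy.

Unset Implicit Arguments.

Theorem theorem4p6 (R : realType) (m : nat) (a b : R)
    (W : set 'rV[R]_m) (U : set (cvec R m))
    (g : 'rV[R]_m -> R -> R) (G : cvec R m -> R -> R[i]) :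
  (0 < m)%N ->
  a < b ->
  open W -> connected W -> W !=set0 -> bounded_set W ->
  (forall x y (t : R), W x -> W y -> 0 <= t <= 1 -> W ((1 - t) *: x + t *: y)) ->
  (forall w, W w -> Linf a b (g w)) ->
  open U -> (forall x, closure W x -> U (creal x)) ->
  (forall z, U z -> LinfC a b (G z)) ->
  (forall w, W w -> linfC a b (fun t => G (creal w) t - (g w t)%:C%C) = 0%E) ->
  holomorphic_Linf a b U G ->
  bounded_on_compacts a b U G ->
  exists C4 C5 C : R, 0 < C4 /\ 0 < C5 /\ 0 < C /\
    forall n : nat, (1 <= n)%N ->
      (kwidth a b (g @` W) n <= (C * expR (- C4 * n%:R `^ m%:R^-1))%:E)%E /\
      (entropy_num a b (B1 a b (g @` W)) n
         <= (C * expR (- C5 * n%:R `^ (m.+1)%:R^-1))%:E)%E.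
Proof.
move=> m0 _ _ _ _ boundedW _ _ openU WU GL Gg holoG bddG.
have [J [M [M0 approx]]] := uniform_approximation boundedW openU WU GL Gg holoG bddG.
have approxD N n : (J * N ^ m <= n)%N -> exists B : nat -> R -> R,
    (forall i, Linf a b (B i)) /\ (forall i, (linf a b (B i) <= M%:E)%E) /\
    forall f, (g @` W) f -> exists k : nat -> R, (forall i, `|k i| <= 1) /\
      (linf a b (fun t => f t - \sum_(i < n) k i * B i t)%R <= (M / 2 ^+ N)%:E)%E.
  move=> /approx[B [BL [BM Bk]]]; exists B; split=> //; split=> // _ [w Ww <-].
  exact: Bk.
(* For N >= 1 the number of bits ((m + 1) N + 2) J N^m is at most J (m + 3) N^(m + 1); the successor
   keeps [L] positive when [J] is 0. *)
pose L := (J * (m + 3)).+1.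
have ln2 : 0 < ln 2 :> R by apply: ln_gt0; rewrite ltr1n.
pose K := 1 + M + J%:R * M.
have K1 : 1 <= K by rewrite /K -addrA lerDl addr_ge0 ?mulr_ge0// ltW.
have MK : M <= K by rewrite /K addrAC lerDr addr_ge0 ?mulr_ge0// ltW.
have K0 : 0 < K by rewrite (lt_le_trans ltr01).
have weaken (x r : R) N : x <= K -> (2 ^+ N)^-1 <= 2 * expR r ->
    x / 2 ^+ N <= 2 * K * expR r.
  move=> xK Nr; rewrite [2 * K]mulrC -mulrA.
  apply: (@le_trans _ _ (K / 2 ^+ N)); last by rewrite ler_wpM2l// ltW.
  by rewrite ler_wpM2r// invr_ge0 exprn_ge0.
exists (ln 2 / J.+1%:R), (ln 2 / L%:R), (2 * K).
split; first by rewrite divr_gt0.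
split; first by rewrite divr_gt0.
split; first by rewrite mulr_gt0.
move=> n _; split.
  have [N [Nn Nr]] := budget_rate R n (ltn0Sn J) m0.
  have Jn : (J * N ^ m <= n)%N by rewrite (leq_trans _ Nn)// leq_mul2r leqnSn orbT.
  by rewrite (le_trans (kwidth_le approxD Jn))// lee_fin weaken.
have [N [Nn Nr]] := budget_rate R n (ltn0Sn (J * (m + 3))) (ltn0Sn m).
have bits : ((m.+1 * N + 2) * (J * N ^ m) <= n)%N.
  (* For N = 0 the absorption of the constant 2 fails, but no coefficients remain because m > 0. *)
  apply: leq_trans Nn; case: N {Nr} => [|N]; first by rewrite exp0n// !muln0.
  apply: (@leq_trans (J * (m + 3) * N.+1 ^ m.+1)); last by rewrite leq_mul2r leqnSn orbT.
  have h : (m.+1 * N.+1 + 2 <= (m + 3) * N.+1)%N by lia.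
  by rewrite (leq_trans (leq_mul h (leqnn _)))// expnS mulnACA (mulnC J).
by rewrite (le_trans (entropy_num_le m0 M0 approxD bits))// lee_fin weaken.
Qed.
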